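(* For each of the three pairs $S\in\{(P_1,P_4),\,(P_1,P_5),\,(P_2,P_3)\}$, as formal power series in $x$, $$\sum_{n\ge 0}|\mathcal{M}_n(S)|\,x^n=\frac{1-4x+5x^2-x^3}{(1-x)(1-2x)^2}.$$
   Context: A matching with $n$ arcs is a partition of $\{1,2,\ldots,2n\}$ into blocks of size 2, called arcs; an arc is written $[a,b]$ with $a<b$, where $a$ is its opener and $b$ its closer. For $n=0$ there is exactly one (empty) matching. A matching is Stoimenow if it contains no pair of arcs $[i,\ell],[i+1,k]$ with $i+1<k<\ell$ (Type 1) and no pair of arcs $[k,j+1],[\ell,j]$ with $k<\ell<j$ (Type 2). A matching $M$ contains a pattern (a matching) $P$ with $m$ arcs if some $m$ arcs of $M$ become $P$ after their $2m$ endpoints are relabelled $1,\ldots,2m$ in the order-preserving way; otherwise $M$ avoids $P$. $\mathcal{M}_n(S)$ denotes the set of Stoimenow matchings with $n$ arcs avoiding every pattern in $S$. The patterns are $P_1=\{[1,3],[2,7],[4,5],[6,8]\}$, $P_2=\{[1,3],[2,5],[4,7],[6,8]\}$, $P_3=\{[1,2],[3,5],[4,6],[7,8]\}$, $P_4=\{[1,2],[3,5],[4,7],[6,8]\}$, $P_5=\{[1,3],[2,5],[4,6],[7,8]\}$. *)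

(* Defs.v *)
From mathcomp Require Import all_boot all_order all_algebra.

Set Implicit Arguments.
Unset Strict Implicit.
Unset Printing Implicit Defensive.

Import GRing.Theory.

(* The point i : 'I_(2 * n) carries the label i.+1, so that labels range over *)
(* 1, ..., 2n.                                                                *)
Notation diagram n := {set {set 'I_(2 * n)}}.

Definition is_matching n (M : diagram n) : bool :=
  partition M [set: 'I_(2 * n)] && [forall B : {set 'I_(2 * n)} in M, #|B| == 2].

Definition arc n (M : diagram n) (a b : 'I_(2 * n)) : bool :=
  (a < b) && ([set a; b] \in M).

Definition has_type1 n (M : diagram n) : bool :=
  [exists i : 'I_(2 * n), exists i' : 'I_(2 * n),
   exists k : 'I_(2 * n), exists l : 'I_(2 * n),
   [&& i' == i.+1 :> nat, i' < k, k < l, arc M i l & arc M i' k]].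

Definition has_type2 n (M : diagram n) : bool :=
  [exists k : 'I_(2 * n), exists l : 'I_(2 * n),
   exists j : 'I_(2 * n), exists j' : 'I_(2 * n),
   [&& j' == j.+1 :> nat, k < l, l < j, arc M k j' & arc M l j]].

Definition stoimenow n (M : diagram n) : bool :=
  ~~ has_type1 M && ~~ has_type2 M.

(* f is the inverse of the order-preserving relabelling of the endpoints of   *)
(* the selected arcs, which are the images of the blocks of P.                *)
Definition contains m n (M : diagram n) (P : diagram m) : bool :=
  [exists f : {ffun 'I_(2 * m) -> 'I_(2 * n)},
    [forall i : 'I_(2 * m), forall j : 'I_(2 * m), (i < j) ==> (f i < f j)] &&
    [forall B : {set 'I_(2 * m)} in P, (f @: B) \in M]].

Definition avoids m n (M : diagram n) (P : diagram m) : bool :=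
  ~~ contains M P.

Definition stoimenow_avoiding m (S : seq (diagram m)) n : {set diagram n} :=
  [set M : diagram n | [&& is_matching M, stoimenow M & all (avoids M) S]].

Definition of_arcs n (s : seq (nat * nat)) : diagram n :=
  [set:: [seq [set i : 'I_(2 * n) | (i.+1 == p.1) || (i.+1 == p.2)] | p <- s]].

Definition P1 : diagram 4 := of_arcs 4 [:: (1, 3); (2, 7); (4, 5); (6, 8)].
Definition P2 : diagram 4 := of_arcs 4 [:: (1, 3); (2, 5); (4, 7); (6, 8)].
Definition P3 : diagram 4 := of_arcs 4 [:: (1, 2); (3, 5); (4, 6); (7, 8)].
Definition P4 : diagram 4 := of_arcs 4 [:: (1, 2); (3, 5); (4, 7); (6, 8)].
Definition P5 : diagram 4 := of_arcs 4 [:: (1, 3); (2, 5); (4, 6); (7, 8)].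

Local Open Scope ring_scope.

(* A formal power series is its sequence of coefficients; two of them are     *)
(* compared with =1.                                                          *)
Definition fps (R : Type) := nat -> R.

Definition fps_of_poly (R : nzRingType) (p : {poly R}) : fps R := fun n => p`_n.

Definition fps_mul (R : nzRingType) (f g : fps R) : fps R :=
  fun n => \sum_(k < n.+1) f k * g (n - k)%N.

Fixpoint fps_inv_seq (R : unitRingType) (f : fps R) (n : nat) : seq R :=
  if n is m.+1 then
    let s := fps_inv_seq f m in
    rcons s (- (f 0%N)^-1 * \sum_(k < m.+1) f k.+1 * s`_(m - k))
  else [:: (f 0%N)^-1].

(* Multiplicative inverse when the constant coefficient is a unit, see        *)
(* fps_mulrV.                                                                 *)
Definition fps_inv (R : unitRingType) (f : fps R) : fps R :=
  fun n => (fps_inv_seq f n)`_n.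

Definition fps_div (R : unitRingType) (f g : fps R) : fps R :=
  fps_mul f (fps_inv g).

Lemma size_fps_inv_seq (R : unitRingType) (f : fps R) n :
  size (fps_inv_seq f n) = n.+1.
Proof. by elim: n => //= n IHn; rewrite size_rcons IHn. Qed.

Lemma nth_fps_inv_seq (R : unitRingType) (f : fps R) n i :
  (i <= n)%N -> (fps_inv_seq f n)`_i = fps_inv f i.
Proof.
elim: n => [|n IHn]; first by rewrite leqn0 => /eqP->.
rewrite leq_eqVlt => /predU1P[-> //|]; rewrite ltnS => le_in.
by rewrite /= nth_rcons size_fps_inv_seq ltnS le_in IHn.
Qed.

Lemma fps_invS (R : unitRingType) (f : fps R) n :
  fps_inv f n.+1 =
    - (f 0%N)^-1 * \sum_(k < n.+1) f k.+1 * fps_inv f (n - k)%N.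
Proof.
rewrite {1}/fps_inv /= nth_rcons size_fps_inv_seq ltnn eqxx.
by congr (_ * _); apply: eq_bigr => k _; rewrite nth_fps_inv_seq ?leq_subr.
Qed.

Lemma fps_mulrV (R : unitRingType) (f : fps R) :
  f 0%N \is a GRing.unit -> fps_mul f (fps_inv f) =1 fps_of_poly 1.
Proof.
move=> f0U [|n]; rewrite /fps_mul /fps_of_poly coef1.
  by rewrite big_ord1 /fps_inv /= divrr.
by rewrite big_ord_recl subn0 fps_invS mulNr mulrN mulVKr // addNr.
Qed.

(* Main.v *)
Require Import Defs.
From mathcomp Require Import all_boot all_order all_algebra.
From mathcomp Require Import zify ring.

Set Implicit Arguments.
Unset Strict Implicit.
Unset Printing Implicit Defensive.

(** Both sides of the identity are shown to have the coefficients a(0) = 1 and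
    2 a(n+1) = n 2^n + 2.

    A matching is handled through its partner map, the involution exchanging
    the two ends of every arc, and through its word, in which openers are the
    letters U and closers the letters D. Every class considered here is rigid:
    its matchings are determined by their words. It remains to find which Dyck
    words occur and to count them.

    Avoiding P1. Along a run of consecutive openers of a Stoimenow matching,
    and along a run of consecutive closers, partners increase. So if an arc is
    nested in another one, some closer lies between their openers and some
    opener between their closers ([nested_gaps]), and the arcs of well chosen
    such points complete an occurrence of P1. Hence the Stoimenow matchings
    avoiding P1 are the nonnesting ones ([nonnestingP]), one for each Dyck
    word. Let r be the length of the initial run of openers. The first r
    closers end the arcs of that run, and P4 is avoided exactly when the
    remaining arcs fall into successive blocks of pairwise crossing arcs. On words:
    a valley (a letter U right after a letter D) preceded by more than r
    letters D has height 0 ([no_P4_late_valleys], [late_valleys_no_P4]). The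
    pair (P1, P5) is the mirror image of (P1, P4).

    Avoiding P2 and P3. In a Stoimenow matching these patterns reduce to
    statements on two crossing arcs ([no_wide_crossing], [no_inner_crossing]).
    Avoiding them forces the arc [v, v'-1] whenever v and v' are consecutive valleys
    ([serial_peaked]), and every arc that has a closer before it and an opener
    after it is one of these ([serial_inner_arc]). All other arcs are pairwise
    nonnesting, hence determined by the word ([serial_unique]). The words that
    occur are the Dyck words without letters D, UU, DD, U in this order
    ([serial_not_wide]). Conversely, for such a word, matching consecutive
    valleys and then the remaining letters in a nonnesting way gives a matching
    of the class ([dyck_peaked], [peaked_serial]).

    Counting. Both conditions on words are checked by an automaton. The number
    of completions of a prefix depends only on the state, the height and the
    number of letters U to come, and satisfies recurrences of Pascal type.
    Summing over the length of the initial run gives diagonal sums of these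
    numbers, which obey first order recurrences ([diagonal_sumS]). *)

(** * Matchings as involutions *)

Definition pairing N (p : nat -> nat) : Prop :=
  forall x, x < N -> [/\ p x < N, p x <> x & p (p x) = x].

(** The value 0 is only a default: in a matching every point has a partner. *)
Definition partner n (M : diagram n) (x : nat) : nat :=
  oapp val 0 [pick y : 'I_(2 * n) |
    [exists a : 'I_(2 * n), [&& a == x :> nat, y != a & [set a; y] \in M]]].

Definition diagram_of n (p : nat -> nat) : diagram n :=
  [set [set y : 'I_(2 * n) | (y == x) || (y == p x :> nat)] | x : 'I_(2 * n)].

Lemma matching_uniq n (M : diagram n) (x y z : 'I_(2 * n)) :
  is_matching M -> y != x -> [set x; y] \in M -> [set x; z] \in M -> y = z.
Proof.
case/andP=> /and3P[_ tM _] _ yx xyM xzM.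
have: [set x; y] = [set x; z].
  rewrite -(def_pblock (x := x) tM xyM) ?(def_pblock (x := x) tM xzM) //;
  by rewrite !inE eqxx.
by move/setP/(_ y); rewrite !inE eqxx orbT (negPf yx) => /esym/eqP.
Qed.

Lemma matching_ex n (M : diagram n) (x : 'I_(2 * n)) :
  is_matching M -> exists2 y, y != x & [set x; y] \in M.
Proof.
case/andP=> /and3P[/eqP cM tM _] /forallP M2.
have xB : x \in pblock M x by rewrite mem_pblock cM inE.
have BM : pblock M x \in M by rewrite pblock_mem // cM inE.
have /implyP/(_ BM)/cards2P[a [b [ab E]]] := M2 (pblock M x).
move: xB BM; rewrite E !inE => /orP[] /eqP-> abM; [exists b | exists a] => //.
  by rewrite eq_sym.
by rewrite setUC.
Qed.

Lemma partnerE n (M : diagram n) (x y : 'I_(2 * n)) :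
  is_matching M -> y != x -> ([set x; y] \in M) = (partner M x == y).
Proof.
move=> mM yx; rewrite /partner; case: pickP => [z /existsP[a]|no] /=.
  case/and3P=> /eqP/val_inj-> zx xzM; apply/idP/eqP => [xyM|/val_inj <- //].
  by rewrite (matching_uniq mM yx xyM xzM).
have [z zx xzM] := matching_ex x mM.
have /negP[] := negbT (no z).
by apply/existsP; exists x; rewrite eqxx zx xzM.
Qed.

Lemma partner_pairing n (M : diagram n) :
  is_matching M -> pairing (2 * n) (partner M).
Proof.
move=> mM x xN; have [y yx xyM] := matching_ex (Ordinal xN) mM.
have /eqP px : partner M (Ordinal xN) == y by rewrite -partnerE.
rewrite /= in px; rewrite px; split; first exact: ltn_ord.
  by move/eqP; rewrite -[x]/(val (Ordinal xN)) val_eqE (negPf yx).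
by apply/eqP; rewrite -[x]/(val (Ordinal xN)) -partnerE 1?eq_sym // setUC.
Qed.

Lemma diagram_of_matching n p : pairing (2 * n) p -> is_matching (diagram_of n p).
Proof.
move=> pp; apply/andP; split; last first.
  apply/forallP=> B; apply/implyP=> /imsetP[x _ ->].
  have [lt neq _] := pp x (ltn_ord x).
  rewrite (_ : [set _ | _] = [set x; Ordinal lt]) ?cards2.
    by case: (x =P _) => [/(congr1 (@nat_of_ord _)) /= /esym|].
  by apply/setP=> y; rewrite !inE.
apply/and3P; split.
- apply/eqP/setP=> x; rewrite inE; apply/bigcupP.
  exists [set y : 'I_(2 * n) | (y == x) || (y == p x :> nat)].
    exact: imset_f.
  by rewrite inE eqxx.
- apply/trivIsetP=> _ _ /imsetP[x _ ->] /imsetP[y _ ->] neq.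
  apply/pred0P=> z /=; apply/negP=> /andP[]; rewrite !inE => h1 h2.
  case/eqP: neq; apply/setP=> t; rewrite !inE.
  have [ltx nx ix] := pp x (ltn_ord x); have [lty ny iy] := pp y (ltn_ord y).
  have eqv (a b : 'I_(2 * n)) : (a == b) = (a == b :> nat) by [].
  rewrite !eqv in h1 h2 *.
  have [exy|exy] : nat_of_ord x = y \/ nat_of_ord x = p y.
  + case/orP: h1 => /eqP h1; case/orP: h2 => /eqP h2; rewrite h1 in h2.
    * by left. * by right. * by right; rewrite -h2 ix. * by left; rewrite -ix h2 iy.
  + by rewrite exy.
  + by rewrite exy iy orbC.
- apply/imsetP=> -[x _ /setP/(_ x)]; by rewrite !inE eqxx.
Qed.

Lemma partner_diagram_of n p x :
  pairing (2 * n) p -> x < 2 * n -> partner (diagram_of n p) x = p x.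
Proof.
move=> pp xN; have [lt neq _] := pp x xN.
apply/eqP; have mM := diagram_of_matching pp.
rewrite -[x]/(nat_of_ord (Ordinal xN)) -[X in _ == X]/(nat_of_ord (Ordinal lt)).
rewrite -partnerE //; last by apply/eqP => /(congr1 (@nat_of_ord _)).
apply/imsetP; exists (Ordinal xN) => //; apply/setP=> y.
by rewrite !inE.
Qed.

Lemma partner_inj n (M M' : diagram n) :
  is_matching M -> is_matching M' ->
  (forall x, x < 2 * n -> partner M x = partner M' x) -> M = M'.
Proof.
suff sub (A B : diagram n) : is_matching A -> is_matching B ->
    (forall x, x < 2 * n -> partner A x = partner B x) -> A \subset B.
  move=> mM mM' e; apply/eqP; rewrite eqEsubset.
  by apply/andP; split; apply: sub => // x xN; rewrite e.
move=> mA mB e; apply/subsetP=> X XA.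
have /cards2P[a [b [ab E]]] : #|X| == 2.
  by case/andP: mA => _ /forallP/(_ X)/implyP; apply.
have ba : b != a by rewrite eq_sym.
by move: XA; rewrite E !partnerE // e.
Qed.

Lemma arcE n (M : diagram n) (a b : 'I_(2 * n)) :
  is_matching M -> Defs.arc M a b = (a < b) && (partner M a == b).
Proof.
move=> mM; rewrite /Defs.arc; case: (ltnP a b) => //= ab; rewrite partnerE //.
by rewrite -val_eqE /= gtn_eqF.
Qed.

Definition stoimenow_pairing N (p : nat -> nat) : Prop :=
  (forall i, i.+1 < N -> i < p i -> i.+1 < p i.+1 -> p i < p i.+1) /\
  (forall j, j.+1 < N -> p j < j -> p j.+1 < j.+1 -> p j < p j.+1).

Lemma stoimenowP n (M : diagram n) : is_matching M ->
  reflect (stoimenow_pairing (2 * n) (partner M)) (stoimenow M).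
Proof.
move=> mM; have pp := partner_pairing mM; apply: (iffP andP) => [[t1 t2]|[s1 s2]].
  split=> [i iN oi oi'|j jN cj cj'].
    rewrite ltnNge; apply: contra t1 => le.
    have [a1 a2 a3] := pp i (ltnW iN); have [b1 b2 b3] := pp _ iN.
    apply/existsP; exists (Ordinal (ltnW iN)); apply/existsP; exists (Ordinal iN).
    apply/existsP; exists (Ordinal b1); apply/existsP; exists (Ordinal a1).
    rewrite !arcE //= !eqxx oi oi' !andbT /=.
    have : partner M i.+1 <> partner M i by move=> e; move: a3; rewrite -e b3; lia.
    lia.
  rewrite ltnNge; apply: contra t2 => le.
  have [a1 a2 a3] := pp j (ltnW jN); have [b1 b2 b3] := pp _ jN.
  apply/existsP; exists (Ordinal b1); apply/existsP; exists (Ordinal a1).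
  apply/existsP; exists (Ordinal (ltnW jN)); apply/existsP; exists (Ordinal jN).
  rewrite !arcE //= a3 b3 !eqxx cj cj' !andbT /=.
  have : partner M j.+1 <> partner M j by move=> e; move: a3; rewrite -e b3; lia.
  lia.
split; apply/negP.
  case/existsP=> i /existsP[i' /existsP[k /existsP[l]]]; rewrite !arcE //.
  case/and5P=> /eqP ei ik kl /andP[il /eqP pi] /andP[_ /eqP pi'].
  have := s1 i; rewrite -ei pi pi'; move: (ltn_ord i'); lia.
case/existsP=> k /existsP[l /existsP[j /existsP[j']]]; rewrite !arcE //.
case/and5P=> /eqP ej kl lj /andP[kj /eqP pk] /andP[_ /eqP pl].
have pj' : partner M j' = k by rewrite -pk; case: (pp k (ltn_ord _)).
have pj : partner M j = l by rewrite -pl; case: (pp l (ltn_ord _)).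
have := s2 j; rewrite -ej pj pj'; move: (ltn_ord j'); lia.
Qed.

(** An embedding is recorded by the increasing list [x] of its values, so that
    containment becomes a matter of inequalities between natural numbers. *)
Definition occurrence N (p : nat -> nat) m (s : seq (nat * nat)) (x : seq nat) : bool :=
  [&& size x == 2 * m, sorted ltn x, all (gtn N) x &
      all (fun q => p (nth 0 x q.1.-1) == nth 0 x q.2.-1) s].

Definition occurs N p m s : Prop := exists x, occurrence N p m s x.

Lemma containsP n m (M : diagram n) (s : seq (nat * nat)) : is_matching M ->
  all (fun q => [&& 0 < q.1, q.1 < q.2 & q.2 <= 2 * m]) s ->
  reflect (occurs (2 * n) (partner M) m s) (contains M (of_arcs m s)).
Proof.
move=> mM /allP hs0.
have hs (q : nat * nat) (qs : q \in s) := hs0 q qs.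
have blockE (f : {ffun 'I_(2 * m) -> 'I_(2 * n)}) q (h1 : q.1.-1 < 2 * m) (h2 : q.2.-1 < 2 * m) :
    q \in s -> f @: [set i : 'I_(2 * m) | (i.+1 == q.1) || (i.+1 == q.2)]
      = [set f (Ordinal h1); f (Ordinal h2)].
  move=> qs; rewrite (_ : [set i | _] = [set Ordinal h1; Ordinal h2]).
    by rewrite imsetU1 imset_set1.
  apply/setP=> i; rewrite !inE -!val_eqE /=.
  by have /and3P[] := hs q qs; lia.
have bnd (q : nat * nat) : q \in s -> (q.1.-1 < 2 * m) /\ (q.2.-1 < 2 * m).
  by case/hs/and3P; lia.
apply: (iffP existsP) => [[f /andP[/forallP fi /forallP fM]]|[x]].
  have fi' (i j : 'I_(2 * m)) : i < j -> f i < f j.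
    by move=> ij; have /forallP/(_ j)/implyP := fi i; apply.
  exists [seq val (f i) | i <- enum 'I_(2 * m)].
  have nthE i (h : i < 2 * m) : nth 0 [seq val (f i) | i <- enum 'I_(2 * m)] i = f (Ordinal h).
    rewrite (nth_map (Ordinal h)) ?size_enum_ord //; congr (nat_of_ord (f _)).
    by apply: val_inj; rewrite /= nth_enum_ord.
  apply/and4P; split.
  - by rewrite size_map size_enum_ord.
  - rewrite sorted_map; apply: (@sub_sorted _ (relpre val ltn)).
      by move=> i j /= /fi'.
    by rewrite -sorted_map val_enum_ord iota_ltn_sorted.
  - by apply/allP=> _ /mapP[i _ ->] /=.
  - apply/allP=> q qs; have [h1 h2] := bnd q qs; rewrite !nthE -partnerE //.
      rewrite -blockE //; apply: (implyP (fM _)); rewrite inE.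
      exact: (map_f (fun p => [set i : 'I_(2 * m) | (i.+1 == p.1) || (i.+1 == p.2)])).
    rewrite -val_eqE /= gtn_eqF //; apply: fi' => /=.
    by have /and3P[] := hs q qs; lia.
case/and4P=> /eqP sx ox /allP xN /allP xs.
have nN i : i < 2 * m -> nth 0 x i < 2 * n.
  by move=> h; apply: xN; rewrite mem_nth ?sx.
exists [ffun i : 'I_(2 * m) => Ordinal (nN i (ltn_ord i))].
have mono i j : i < j -> j < 2 * m -> nth 0 x i < nth 0 x j.
  move=> ij jm; apply: (sorted_ltn_nth ltn_trans 0 ox) => //; rewrite inE sx //.
  exact: ltn_trans jm.
apply/andP; split.
  by apply/forallP=> i; apply/forallP=> j; apply/implyP=> ij; rewrite !ffunE /= mono.
apply/forallP=> B; apply/implyP; rewrite inE => /mapP[q qs ->].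
have [h1 h2] := bnd q qs; rewrite blockE // !ffunE partnerE //=.
  exact: xs.
rewrite -val_eqE /= gtn_eqF // mono //.
by have /and3P[] := hs q qs; lia.
Qed.

(** * Runs of openers and of closers *)

Lemma least_from (P : pred nat) a b : a <= b -> P b ->
  exists c, [/\ a <= c, c <= b, P c & forall x, a <= x -> x < c -> ~~ P x].
Proof.
move=> ab Pb; have ex : exists c, (a <= c) && P c by exists b; rewrite ab.
case: (ex_minnP ex) => c /andP[ac Pc] cmin; exists c; split => // [|x ax xc].
  by apply: cmin; rewrite ab.
by apply/negP=> Px; have := cmin x; rewrite ax Px; lia.
Qed.

Lemma greatest_upto (P : pred nat) a b : a <= b -> P a ->
  exists c, [/\ a <= c, c <= b, P c & forall x, c < x -> x <= b -> ~~ P x].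
Proof.
move=> ab Pa; have ex : exists c, (c <= b) && P c by exists a; rewrite ab.
have ub c : (c <= b) && P c -> c <= b by case/andP.
case: (ex_maxnP ex ub) => c /andP[cb Pc] cmax; exists c; split => // [|x cx xb].
  by apply: cmax; rewrite ab.
by apply/negP=> Px; have := cmax x; rewrite xb Px; lia.
Qed.

Lemma pairing_lt N p x : pairing N p -> x < N -> p x < N.
Proof. by move=> pp /pp[]. Qed.

Lemma pairing_neq N p x : pairing N p -> x < N -> p x <> x.
Proof. by move=> pp /pp[]. Qed.

Lemma pairingK N p x : pairing N p -> x < N -> p (p x) = x.
Proof. by move=> pp /pp[]. Qed.

Lemma pairing_closer N p x : pairing N p -> x < N -> ~~ (x < p x) = (p x < x).
Proof. by move=> pp xN; have := pairing_neq pp xN; lia. Qed.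

Lemma pairing_inj N p x y :
  pairing N p -> x < N -> y < N -> p x = p y -> x = y.
Proof. by move=> pp xN yN e; rewrite -(pairingK pp xN) e (pairingK pp). Qed.

(** The partner map of the matching reflected left to right. *)
Definition mirror N (p : nat -> nat) (x : nat) : nat := N.-1 - p (N.-1 - x).

Lemma mirror_pairing N p : pairing N p -> pairing N (mirror N p).
Proof.
move=> pp x xN; have h : N.-1 - x < N by lia.
have [lt neq e] := pp _ h; rewrite /mirror; split; try lia.
by rewrite (_ : N.-1 - (N.-1 - p (N.-1 - x)) = p (N.-1 - x)) ?e; lia.
Qed.

Lemma mirrorK N p x : pairing N p -> x < N -> mirror N (mirror N p) x = p x.
Proof.
move=> pp xN; rewrite /mirror (_ : N.-1 - (N.-1 - x) = x); last lia.
by have := pairing_lt pp xN; lia.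
Qed.

Lemma mirror_stoimenow N p : pairing N p ->
  stoimenow_pairing N p -> stoimenow_pairing N (mirror N p).
Proof.
move=> pp [s1 s2]; rewrite /mirror; split=> i iN.
  have := s2 (N.-1 - i.+1); rewrite (_ : (N.-1 - i.+1).+1 = N.-1 - i); last lia.
  have [] := pp (N.-1 - i); first lia.
  have [] := pp (N.-1 - i.+1); first lia.
  by lia.
have := s1 (N.-1 - i.+1); rewrite (_ : (N.-1 - i.+1).+1 = N.-1 - i); last lia.
have [] := pp (N.-1 - i); first lia.
have [] := pp (N.-1 - i.+1); first lia.
by lia.
Qed.

(** Arcs of adjacent openers are not nested, so partners increase at every step
    of the run. *)
Lemma opener_run N p a b : stoimenow_pairing N p -> a < b -> b < N ->
  (forall x, a <= x -> x <= b -> x < p x) -> p a < p b.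
Proof.
move=> [s1 _]; elim: b => // b IH ab bN op.
have hb : p b < p b.+1 by apply: s1 => //; apply: op; lia.
have [->//|ne] := eqVneq a b.
suff: p a < p b by lia.
apply: IH; try lia.
by move=> x ax xb; apply: op; lia.
Qed.

Lemma closer_run N p a b : stoimenow_pairing N p -> a < b -> b < N ->
  (forall x, a <= x -> x <= b -> p x < x) -> p a < p b.
Proof.
move=> [_ s2]; elim: b => // b IH ab bN op.
have hb : p b < p b.+1 by apply: s2 => //; apply: op; lia.
have [->//|ne] := eqVneq a b.
suff: p a < p b by lia.
apply: IH; try lia.
by move=> x ax xb; apply: op; lia.
Qed.

(** The first closer after [x] works: if its arc were opened after [x], it would
    be opened in the run of openers starting at [x], and [opener_run] would put
    [p x] before it. *)
Lemma closer_across N p x c : pairing N p -> stoimenow_pairing N p ->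
  x < c -> c < p x -> x < N -> p c < c ->
  exists y, [/\ x < y, y <= c, p y < x & y < N].
Proof.
move=> pp sp xc cpx xN cc; have pxN := pairing_lt pp xN.
have cN : c < N by lia.
have [y [xy yc cy ymin]] := @least_from (fun y => p y < y) x.+1 c xc cc.
exists y; split=> //; last lia.
have yN : y < N by lia.
have pyK := pairingK pp yN; have pxK := pairingK pp xN.
case: (ltnP x (p y)) => [lt|]; last first.
  rewrite leq_eqVlt => /orP[/eqP e|//]; rewrite e in pyK; lia.
have : p x < p (p y).
  apply: (opener_run sp) => //; first lia.
  move=> z; rewrite leq_eqVlt => /orP[/eqP<-|xz]; first by lia.
  move=> zpy; have := ymin z xz; have := @pairing_neq N p z pp; lia.
lia.
Qed.

(** The mirror image of [closer_across]. *)
Lemma opener_across N p x c : pairing N p -> stoimenow_pairing N p ->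
  p x < c -> c < x -> x < N -> c < p c ->
  exists y, [/\ c <= y, y < x, x < p y & p y < N].
Proof.
move=> pp sp xc cpx xN cc.
have [||||y [h1 h2 h3 h4]] := closer_across (x := N.-1 - x) (c := N.-1 - c)
  (mirror_pairing pp) (mirror_stoimenow pp sp); rewrite /mirror.
- lia.
- by rewrite (_ : N.-1 - (N.-1 - x) = x); lia.
- lia.
- have := @pairing_lt N p c pp; rewrite (_ : N.-1 - (N.-1 - c) = c); lia.
move: h3; rewrite /mirror => h3; exists (N.-1 - y).
have := @pairing_lt N p (N.-1 - y) pp; split; lia.
Qed.

(** * Patterns in Stoimenow matchings *)

Definition arcs1 := [:: (1, 3); (2, 7); (4, 5); (6, 8)].
Definition arcs2 := [:: (1, 3); (2, 5); (4, 7); (6, 8)].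
Definition arcs3 := [:: (1, 2); (3, 5); (4, 6); (7, 8)].
Definition arcs4 := [:: (1, 2); (3, 5); (4, 7); (6, 8)].
Definition arcs5 := [:: (1, 3); (2, 5); (4, 6); (7, 8)].

Lemma occurrence8 N p s :
  occurs N p 4 s ->
  exists x1 x2 x3 x4 x5 x6 x7 x8,
    occurrence N p 4 s [:: x1; x2; x3; x4; x5; x6; x7; x8].
Proof.
case=> x ox; case/and4P: (ox) => sx _ _ _; move: x sx ox.
by do 8![case=> [//|?]]; case=> // _ ox; do 8 eexists; exact: ox.
Qed.

Lemma occurrence_P1 N p :
  occurs N p 4 arcs1 <->
  (exists a b c d,
    [&& a < b, b < p a, p a < c, c < p c, p c < d, d < p b, p b < p d & p d < N]).
Proof.
split=> [/occurrence8|].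
  case=> x1 [x2 [x3 [x4 [x5 [x6 [x7 [x8]]]]]]]; rewrite /occurrence /= => H.
  by exists x1, x2, x4, x6; lia.
case=> a [b [c [d H]]]; exists [:: a; b; p a; c; p c; d; p b; p d].
by rewrite /occurrence /=; lia.
Qed.

Lemma occurrence_P2 N p :
  occurs N p 4 arcs2 <->
  (exists a b c d,
    [&& a < b, b < p a, p a < c, c < p b, p b < d, d < p c, p c < p d & p d < N]).
Proof.
split=> [/occurrence8|].
  case=> x1 [x2 [x3 [x4 [x5 [x6 [x7 [x8]]]]]]]; rewrite /occurrence /= => H.
  by exists x1, x2, x4, x6; lia.
case=> a [b [c [d H]]]; exists [:: a; b; p a; c; p b; d; p c; p d].
by rewrite /occurrence /=; lia.
Qed.

Lemma occurrence_P3 N p :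
  occurs N p 4 arcs3 <->
  (exists a b c d,
    [&& a < p a, p a < b, b < c, c < p b, p b < p c, p c < d, d < p d & p d < N]).
Proof.
split=> [/occurrence8|].
  case=> x1 [x2 [x3 [x4 [x5 [x6 [x7 [x8]]]]]]]; rewrite /occurrence /= => H.
  by exists x1, x3, x4, x7; lia.
case=> a [b [c [d H]]]; exists [:: a; p a; b; c; p b; p c; d; p d].
by rewrite /occurrence /=; lia.
Qed.

Lemma occurrence_P4 N p :
  occurs N p 4 arcs4 <->
  (exists a b c d,
    [&& a < p a, p a < b, b < c, c < p b, p b < d, d < p c, p c < p d & p d < N]).
Proof.
split=> [/occurrence8|].
  case=> x1 [x2 [x3 [x4 [x5 [x6 [x7 [x8]]]]]]]; rewrite /occurrence /= => H.
  by exists x1, x3, x4, x6; lia.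
case=> a [b [c [d H]]]; exists [:: a; p a; b; c; p b; d; p c; p d].
by rewrite /occurrence /=; lia.
Qed.

Lemma occurrence_P5 N p :
  occurs N p 4 arcs5 <->
  (exists a b c d,
    [&& a < b, b < p a, p a < c, c < p b, p b < p c, p c < d, d < p d & p d < N]).
Proof.
split=> [/occurrence8|].
  case=> x1 [x2 [x3 [x4 [x5 [x6 [x7 [x8]]]]]]]; rewrite /occurrence /= => H.
  by exists x1, x2, x4, x7; lia.
case=> a [b [c [d H]]]; exists [:: a; b; p a; c; p b; p c; d; p d].
by rewrite /occurrence /=; lia.
Qed.

Definition nonnesting N (p : nat -> nat) : Prop :=
  forall a u, a < u -> u < p u -> p u < p a -> p a < N -> False.

(** Avoidance of P2 for Stoimenow matchings. The outer arcs of P2 are implied by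
    a closer between the two openers and an opener between the two closers. *)
Definition no_wide_crossing N (p : nat -> nat) : Prop :=
  forall x i k d, x < k -> k < i -> i < p x -> p x < d -> d < p i -> p i < N ->
    p k < k -> d < p d -> False.

(** Avoidance of P3, whose outer arcs only mark a closer before and an opener
    after two crossing arcs. *)
Definition no_inner_crossing N (p : nat -> nat) : Prop :=
  forall a b k d, k < a -> a < b -> b < p a -> p a < p b -> p b < d -> d < N ->
    p k < k -> d < p d -> False.

Lemma nonnesting_stoimenow N p : pairing N p -> nonnesting N p -> stoimenow_pairing N p.
Proof.
move=> pp nn; split=> i iN.
  have neq : p i <> p i.+1 by move/(pairing_inj pp); lia.
  by have := nn i i.+1; have := pairing_lt pp (ltnW iN); lia.
have neq : p i <> p i.+1 by move/(pairing_inj pp); lia.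
have := nn (p i.+1) (p i); rewrite (pairingK pp iN) (pairingK pp (ltnW iN)); lia.
Qed.

(** Without such a closer (opener), a run would join the openers (closers) of the
    two arcs, along which partners increase. *)
Lemma nested_gaps N p a u : pairing N p -> stoimenow_pairing N p ->
  a < u -> u < p u -> p u < p a -> p a < N ->
  (exists k, [/\ a < k, k < u & p k < k]) /\
  (exists d, [/\ p u < d, d < p a & d < p d]).
Proof.
move=> pp sp au up pupa paN; split.
  have [|none] := boolP (has (fun y => p y < y) (index_iota a.+1 u)).
    by case/hasP=> c; rewrite mem_index_iota => /andP[ac cu] cc; exists c.
  suff : p a < p u by lia.
  apply: (opener_run sp) => // [|x ax xu]; first lia.
  have [->//|xu'] := eqVneq x u.
  have [->|xa] := eqVneq x a; first lia.
  have xN : x < N by lia.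
  move/hasPn/(_ x): none; rewrite mem_index_iota.
  by have := pairing_neq pp xN; lia.
have [|none] := boolP (has (fun y => y < p y) (index_iota (p u).+1 (p a))).
  by case/hasP=> d; rewrite mem_index_iota => /andP[ud da] od; exists d.
have [uN aN] : u < N /\ a < N by lia.
have [puK paK] := (pairingK pp uN, pairingK pp aN).
suff : p (p u) < p (p a) by lia.
apply: (closer_run sp) => // x ux xa.
have [->|xa'] := eqVneq x (p a); first lia.
have [->|xu'] := eqVneq x (p u); first lia.
have xN : x < N by lia.
move/hasPn/(_ x): none; rewrite mem_index_iota.
by have := pairing_neq pp xN; lia.
Qed.

(** The closer and the opener given by [nested_gaps] can be chosen on arcs that
    cross the outer arc, which produces P1. *)
Lemma nonnestingP N p : pairing N p ->
  stoimenow_pairing N p /\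
    ~ occurs N p 4 arcs1 <->
  nonnesting N p.
Proof.
move=> pp; rewrite occurrence_P1; split=> [[sp no] a u au up pupa paN|nn]; last first.
  split; first exact: nonnesting_stoimenow.
  case=> a [b [c [d H]]]; apply: (nn b c); lia.
have aN : a < N by lia.
have paK := pairingK pp aN.
have [[k [ak ku kk]] [d [ud da dd]]] := nested_gaps pp sp au up pupa paN.
have [| | | |y [ay yk py yN]] := closer_across (x := a) (c := k) pp sp; try lia.
have [| | | |z [dz za pz zN]] := opener_across (x := p a) (c := d) pp sp; try lia.
by case: no; exists (p y), a, u, z; rewrite (pairingK pp yN); lia.
Qed.

Lemma no_wide_crossingP N p : pairing N p -> stoimenow_pairing N p ->
  ~ occurs N p 4 arcs2 <->
  no_wide_crossing N p.
Proof.
move=> pp sp; rewrite occurrence_P2; split=> [no x i k d xk ki ix xd di iN kk dd|nn].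
  have iN' : i < N by lia. have xN : x < N by lia.
  have piK := pairingK pp iN'; have pxK := pairingK pp xN.
  have [| | | |y [h1 h2 h3 h4]] := closer_across (x := x) (c := k) pp sp; try lia.
  have [| | | |z [k1 k2 k3 k4]] := opener_across (x := p i) (c := d) pp sp; try lia.
  case: no; exists (p y), x, i, z; rewrite (pairingK pp h4); lia.
case=> a [b [c [d H]]]; apply: (nn b c (p a) d); try lia.
by rewrite (pairingK pp); lia.
Qed.

Lemma no_inner_crossingP N p : pairing N p ->
  ~ occurs N p 4 arcs3 <->
  no_inner_crossing N p.
Proof.
move=> pp; rewrite occurrence_P3; split=> [no a b k d ka ab ba papb pbd dN kk dd|nn].
  case: no; exists (p k), a, b, d.
  rewrite (pairingK pp); have := pairing_lt pp dN; lia.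
case=> a [b [c [d H]]]; apply: (nn b c (p a) d); try lia.
by rewrite (pairingK pp); lia.
Qed.

(** * Dyck words and matchings with a given word *)

Definition prefix_count (P : pred nat) t := count P (iota 0 t).

Lemma prefix_countS P t : prefix_count P t.+1 = prefix_count P t + P t.
Proof. by rewrite /prefix_count -addn1 iotaD count_cat /= addn0. Qed.

Lemma prefix_count_mono P s t : s <= t -> prefix_count P s <= prefix_count P t.
Proof.
elim: t => [|t IH]; first by rewrite leqn0 => /eqP->.
rewrite leq_eqVlt => /orP[/eqP->//|/IH]; rewrite prefix_countS; lia.
Qed.

Lemma eq_prefix_count (P Q : pred nat) t :
  (forall x, x < t -> P x = Q x) -> prefix_count P t = prefix_count Q t.
Proof.
by move=> e; apply: eq_in_count => x; rewrite mem_iota => /andP[_ xt]; apply: e.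
Qed.

Lemma prefix_countC (P : pred nat) t :
  prefix_count P t + prefix_count (fun x => ~~ P x) t = t.
Proof. by rewrite count_predC size_iota. Qed.

Lemma prefix_countD1 (P : pred nat) t x : x < t -> P x ->
  prefix_count P t = (prefix_count (fun u => P u && (u != x)) t).+1.
Proof.
move=> xt Px; elim: t xt => // t IH; rewrite ltnS !prefix_countS leq_eqVlt.
case/orP=> [/eqP e|xt]; last first.
  have ->: (t != x) = true by lia.
  by rewrite IH // andbT addSn.
rewrite e in Px *; rewrite Px eqxx addn0 addn1; congr _.+1.
apply: eq_prefix_count => u ut; have ->: (u != t) = true by lia.
by rewrite andbT.
Qed.

Lemma index_filter_iota (P : pred nat) N y :
  y < N -> P y -> index y (filter P (iota 0 N)) = prefix_count P y.
Proof.
move=> yN Py; have [k ->] : exists k, N = y + k.+1 by exists (N - y.+1); lia.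
 rewrite iotaD filter_cat index_cat.
rewrite mem_filter Py mem_iota add0n ltnn /= Py /= eqxx addn0 size_filter //.
Qed.

(** Counting by an injection that does not leave the prefix. *)
Lemma leq_prefix_count N (P Q : pred nat) (f : nat -> nat) t :
  t <= N ->
  {in gtn N &, injective f} ->
  (forall x, x < t -> P x -> Q (f x) && (f x < t)) ->
  prefix_count P t <= prefix_count Q t.
Proof.
move=> tN injf h; rewrite /prefix_count -!size_filter -(size_map f).
apply: uniq_leq_size.
  rewrite map_inj_in_uniq ?filter_uniq ?iota_uniq // => x y.
  rewrite !mem_filter !mem_iota => /andP[_ xt] /andP[_ yt].
  by apply: injf; rewrite inE; lia.
move=> z /mapP[x]; rewrite mem_filter mem_iota => /andP[Px xt] ->.
by rewrite mem_filter mem_iota; have := h x; rewrite Px; lia.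
Qed.

Definition dyck_word N (w : pred nat) : Prop :=
  (forall t, t <= N -> prefix_count (fun x => ~~ w x) t <= prefix_count w t) /\
  prefix_count (fun x => ~~ w x) N = prefix_count w N.

Definition opener (p : nat -> nat) : pred nat := fun x => x < p x.

Lemma pairing_dyck N p : pairing N p -> dyck_word N (opener p).
Proof.
move=> pp; have injp : {in gtn N &, injective p}.
  by move=> x y xN yN; apply: (pairing_inj pp).
have le t : t <= N -> prefix_count (fun x => ~~ opener p x) t <= prefix_count (opener p) t.
  move=> tN; apply: (leq_prefix_count tN injp) => x xt; rewrite /opener.
  have xN : x < N by lia.
  by rewrite (pairingK pp xN); have := pairing_neq pp xN; lia.
split=> //; apply/eqP; rewrite eqn_leq le //=.
apply: (leq_prefix_count (leqnn N) injp) => x xN; rewrite /opener.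
by rewrite (pairingK pp xN); have := pairing_lt pp xN; lia.
Qed.

(** The height of the word before [t] is the number of arcs that straddle [t]. If
    it is 0 the partner map sends the closers before [t] onto the openers before
    [t], whereas it could not reach the opener of a straddling arc. *)
Lemma balanced_closed N p t x : pairing N p -> t <= N ->
  prefix_count (fun x => ~~ opener p x) t = prefix_count (opener p) t ->
  x < t -> p x < t.
Proof.
move=> pp tN e xt; rewrite ltnNge; apply/negP=> tp.
have injp : {in gtn N &, injective p}.
  by move=> u v uN vN; apply: (pairing_inj pp).
have : prefix_count (fun x => ~~ opener p x) t <=
    prefix_count (fun u => opener p u && (u != x)) t.
  apply: (leq_prefix_count tN injp) => u ut; rewrite /opener.
  have uN : u < N by lia.
  rewrite (pairingK pp uN); have := pairing_neq pp uN.
  have [xE|] := eqVneq (p u) x; last by lia.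
  by move: tp; rewrite -xE (pairingK pp uN); lia.
have ox : opener p x by rewrite /opener; lia.
by have := prefix_countD1 xt ox; lia.
Qed.

(** The k-th point of [P] is matched with the k-th point of [Q]; the ballot
    condition says that the former comes first. *)
Lemma ballot_matching N (P Q : pred nat) :
  (forall x, x < N -> P x -> ~~ Q x) ->
  (forall t, t <= N -> prefix_count Q t <= prefix_count P t) ->
  prefix_count Q N = prefix_count P N ->
  exists q : nat -> nat,
    [/\ forall x, x < N -> P x -> [/\ x < q x, q x < N, Q (q x) & q (q x) = x],
        forall y, y < N -> Q y -> [/\ q y < y, P (q y) & q (q y) = y] &
        forall x y, x < y -> y < N -> P x -> P y -> q x < q y].
Proof.
move=> disj le e.
pose lP := filter P (iota 0 N); pose lQ := filter Q (iota 0 N).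
have sz : size lP = size lQ by rewrite !size_filter; exact/esym.
pose q x := if P x then nth 0 lQ (index x lP) else nth 0 lP (index x lQ).
have inP x : (x \in lP) = (P x && (x < N)) by rewrite mem_filter mem_iota.
have inQ x : (x \in lQ) = (Q x && (x < N)) by rewrite mem_filter mem_iota.
have uP : uniq lP by rewrite filter_uniq ?iota_uniq.
have uQ : uniq lQ by rewrite filter_uniq ?iota_uniq.
have lt k : k < size lP -> nth 0 lP k < nth 0 lQ k.
  move=> kP; have kQ : k < size lQ by rewrite -sz.
  set x := nth 0 lP k; set y := nth 0 lQ k.
  have : x \in lP by rewrite mem_nth.
  have : y \in lQ by rewrite mem_nth.
  rewrite inP inQ => /andP[Qy yN] /andP[Px xN].
  have kx : k = prefix_count P x by rewrite -(index_filter_iota xN) ?index_uniq.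
  have ky : k = prefix_count Q y by rewrite -(index_filter_iota yN) ?index_uniq.
  have := le y.+1 yN; rewrite !prefix_countS Qy -ky.
  have -> : P y = false by apply/negP=> /(disj y yN); rewrite Qy.
  by move=> h; rewrite ltnNge; apply/negP=> /(prefix_count_mono P); lia.
have qP x : x < N -> P x -> [/\ x < q x, q x < N, Q (q x) & q (q x) = x].
  move=> xN Px; have xP : x \in lP by rewrite inP Px.
  have iP : index x lP < size lP by rewrite index_mem.
  have : q x \in lQ by rewrite /q Px mem_nth -?sz.
  rewrite inQ => /andP[Qq qN]; split=> //.
    by rewrite /q Px -{1}(nth_index 0 xP) lt.
  rewrite {1}/q; have -> : P (q x) = false by apply/negP=> /(disj _ qN); rewrite Qq.
  by rewrite /q Px index_uniq -?sz // nth_index.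
have qQ y : y < N -> Q y -> [/\ q y < y, P (q y) & q (q y) = y].
  move=> yN Qy; have yQ : y \in lQ by rewrite inQ Qy.
  have iQ : index y lQ < size lQ by rewrite index_mem.
  have Py : P y = false by apply/negP=> /(disj y yN); rewrite Qy.
  have : q y \in lP by rewrite /q Py mem_nth ?sz.
  rewrite inP => /andP[Pq qN]; split=> //.
    by rewrite /q Py -{2}(nth_index 0 yQ) lt ?sz.
  by rewrite {1}/q Pq /q Py index_uniq ?sz // nth_index.
exists q; split=> // x y xy yN Px Py; have xN : x < N by lia.
have [_ qx Qx ex] := qP x xN Px; have [_ qy Qy ey] := qP y yN Py.
have iQ z : z < N -> P z -> index (q z) lQ = prefix_count P z.
  move=> zN Pz; rewrite /q Pz index_uniq -?sz ?index_mem ?inP ?Pz //.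
  by rewrite index_filter_iota.
have : prefix_count P x < prefix_count P y.
  by apply: leq_trans (prefix_count_mono P xy); rewrite prefix_countS Px; lia.
rewrite -!iQ // !index_filter_iota // => h; rewrite ltnNge; apply/negP.
by move/(prefix_count_mono Q); lia.
Qed.

Definition nonnesting_off N (S : pred nat) (p : nat -> nat) : Prop :=
  forall a u, ~~ S a -> ~~ S u -> a < u -> u < p u -> p u < p a -> p a < N -> False.

(** At the first opener x outside [S] where, say, p x < q x, the closer p x must
    be matched by q with a later opener, since the earlier ones are taken; this
    gives an arc of q nested in [x, q x]. *)
Lemma nonnesting_unique N (S : pred nat) (p q : nat -> nat) :
  pairing N p -> pairing N q ->
  (forall x, x < N -> opener p x = opener q x) ->
  (forall x, x < N -> S x -> p x = q x /\ S (p x)) ->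
  nonnesting_off N S p -> nonnesting_off N S q ->
  forall x, x < N -> p x = q x.
Proof.
have step r s x : pairing N r -> pairing N s ->
    (forall x, x < N -> opener r x = opener s x) ->
    (forall x, x < N -> S x -> r x = s x /\ S (r x)) ->
    nonnesting_off N S s ->
    (forall z, z < x -> opener r z -> ~~ S z -> r z = s z) ->
    x < N -> opener r x -> ~~ S x -> r x < s x -> False.
  move=> pr ps oE SE ns IH xN ox Sx lt; have rN := pairing_lt pr xN.
  have rK := pairingK pr xN.
  have Sy : ~~ S (r x) by apply: contra Sx => /(SE _ rN)[_]; rewrite rK.
  have cy : ~~ opener s (r x) by rewrite -oE // /opener rK -leqNgt ltnW.
  have zN := pairing_lt ps rN; have sK := pairingK ps rN.
  have zy : s (r x) < r x by rewrite -(pairing_closer ps).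
  have oz : opener r (s (r x)) by rewrite oE // /opener sK.
  have Sz : ~~ S (s (r x)).
    by apply: contra Sy => /(SE _ zN)[]; rewrite sK => ->.
  have [zx|xz|zx] := ltngtP (s (r x)) x.
  - have := IH _ zx oz Sz; rewrite sK => /(pairing_inj pr zN xN) e.
    by rewrite -e sK in lt; lia.
  - apply: (ns x (s (r x))); rewrite ?sK //; exact: pairing_lt.
  - by move: lt; rewrite -{2}zx sK ltnn.
move=> pp pq oE SE np nq.
have main x : x < N -> opener p x -> ~~ S x -> p x = q x.
  elim/ltn_ind: x => x IH xN ox Sx; have [lt|lt|//] := ltngtP (p x) (q x).
    by case: (step p q x) => // z zx oz Sz; apply: IH => //; lia.
  case: (step q p x) => //; last by rewrite -oE.
  - by move=> z zN; rewrite oE.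
  - by move=> z zN /(SE z zN)[-> ?].
  - by move=> z zx oz Sz; rewrite IH ?oE //; lia.
move=> x xN; have [Sx|Sx] := boolP (S x); first by case: (SE x xN Sx).
have [ox|cx] := boolP (opener p x); first exact: main.
have pN := pairing_lt pp xN; have pK := pairingK pp xN.
have : p (p x) = q (p x).
  apply: main => //; first by move: cx; rewrite (pairing_closer pp) // /opener pK.
  by apply: contra Sx => /(SE _ pN)[_]; rewrite pK.
by rewrite pK => e; rewrite {2}e (pairingK pq).
Qed.

Definition word n (M : diagram n) : (2 * n).-tuple bool :=
  [tuple opener (partner M) i | i < 2 * n].

Definition letter (t : seq bool) : pred nat := nth false t.

Lemma letter_word n (M : diagram n) x :
  x < 2 * n -> letter (word M) x = opener (partner M) x.
Proof.
move=> xN; rewrite /letter -[x]/(nat_of_ord (Ordinal xN)) -tnth_nth.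
by rewrite tnth_mktuple.
Qed.

(** The class [A], described by a property [K] of partner maps, is in bijection
    with the words satisfying [W] as soon as [K] forces [W], a word determines
    the matching, and every word of [W] comes from the class. *)
Lemma card_by_words n (A : {set diagram n}) (K : (nat -> nat) -> Prop)
    (W : pred (seq bool)) :
  (forall M, M \in A <-> is_matching M /\ K (partner M)) ->
  (forall p q, (forall x, x < 2 * n -> p x = q x) -> pairing (2 * n) p -> K p -> K q) ->
  (forall p (t : (2 * n).-tuple bool), pairing (2 * n) p -> K p ->
     (forall x, x < 2 * n -> letter t x = opener p x) -> W t) ->
  (forall p q, pairing (2 * n) p -> pairing (2 * n) q -> K p -> K q ->
     (forall x, x < 2 * n -> opener p x = opener q x) ->
     forall x, x < 2 * n -> p x = q x) ->
  (forall t : (2 * n).-tuple bool, W t ->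
     exists p, [/\ pairing (2 * n) p, K p &
       forall x, x < 2 * n -> letter t x = opener p x]) ->
  #|A| = #|[set t : (2 * n).-tuple bool | W t]|.
Proof.
move=> AE Kext toW uniq fromW; rewrite -(card_in_imset (f := @word n) (D := A)).
  congr #|pred_of_set _|; apply/setP=> t; rewrite inE; apply/imsetP/idP.
    case=> M /AE[mM KM] ->; apply: (toW _ _ (partner_pairing mM) KM).
    exact: letter_word.
  case/fromW=> p [pp Kp tE]; have mM := diagram_of_matching pp.
  have pE x := @partner_diagram_of n p x pp.
  exists (diagram_of n p).
    by apply/AE; split=> //; apply: Kext Kp => // x xN; rewrite pE.
  apply: eq_from_tnth => i; rewrite tnth_mktuple (tnth_nth false).
  by rewrite -[nth _ _ _]/(letter t i) tE // /opener pE.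
move=> M M' /AE[mM KM] /AE[mM' KM'] wE; apply: partner_inj => //.
apply: uniq => //; try exact: partner_pairing.
by move=> x xN; rewrite -!letter_word // wE.
Qed.

(** * Nonnesting matchings avoiding P4 *)

Definition valley N (w : pred nat) t := [&& 0 < t, t < N, ~~ w t.-1 & w t].

(** Here [r] is the length of the initial run of U. In a nonnesting matching the
    first [r] letters D close the arcs of that run. A valley that comes later
    opens a new block of crossing arcs, which must not meet the previous blocks. *)
Definition late_valleys_balanced N (w : pred nat) : Prop :=
  forall r t, (forall x, x < r -> w x) -> ~~ w r -> valley N w t ->
    r < prefix_count (fun x => ~~ w x) t ->
    prefix_count (fun x => ~~ w x) t = prefix_count w t.

Lemma closed_balanced N p t : pairing N p -> t <= N ->
  (forall x, x < t -> p x < t) ->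
  prefix_count (fun x => ~~ opener p x) t = prefix_count (opener p) t.
Proof.
move=> pp tN cl; have [le _] := pairing_dyck pp.
apply/eqP; rewrite eqn_leq le //=.
apply: (@leq_prefix_count N _ _ p) => // [x y xN yN|x xt]; first exact: (pairing_inj pp).
rewrite cl // /opener andbT (pairingK pp); lia.
Qed.

Lemma prefix_count_lt r t : prefix_count (fun x => x < r) t = minn r t.
Proof. by elim: t => [|t IH]; rewrite ?prefix_countS ?IH /prefix_count /=; lia. Qed.

Lemma nonnesting_mono N p x y : pairing N p -> nonnesting N p ->
  x < y -> y < N -> opener p y -> p x < p y.
Proof.
rewrite /opener => pp nn xy yN oy; have xN : x < N by lia.
have neq : p x <> p y by move/(pairing_inj pp); lia.
by have := nn x y; have := pairing_lt pp xN; lia.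
Qed.

Lemma nonnesting_mono_closer N p x y : pairing N p -> nonnesting N p ->
  x < y -> y < N -> ~~ opener p x -> p x < p y.
Proof.
rewrite /opener => pp nn xy yN cx; have xN : x < N by lia.
have neq : p x <> p y by move/(pairing_inj pp); lia.
have := nn (p y) (p x); rewrite !(pairingK pp) //.
by have := pairing_neq pp xN; lia.
Qed.

(** At a late valley [t] of positive height, P4 is formed by the arc of the first
    closer, the arc closed at t-1, an arc straddling [t] and the arc opened
    at [t]. *)
Lemma no_P4_late_valleys N p : pairing N p -> nonnesting N p ->
  ~ occurs N p 4 arcs4 ->
  late_valleys_balanced N (opener p).
Proof.
move=> pp nn no r t hr cr /and4P[t0 tN ct ot] lt; apply/eqP; apply: contraT => neq.
case: no; apply/occurrence_P4.
have [k [kt pk]] : exists k, k < t /\ t <= p k.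
  have [al|] := boolP (all (fun x => p x < t) (iota 0 t)).
    case/eqP: neq; apply: (closed_balanced pp (ltnW tN)) => x xt.
    by move/allP: al => /(_ x); rewrite mem_iota; apply.
  case/allPn=> k; rewrite mem_iota -leqNgt => kt pk; by exists k.
have [c [ctt cc pc]] : exists c, [/\ c < t, ~~ opener p c & r <= p c].
  have [/hasP[c]|/hasPn none] := boolP (has (fun c => ~~ opener p c && (r <= p c)) (iota 0 t)).
    by rewrite mem_iota => ctt /andP[]; exists c.
  move: lt; rewrite ltnNge => /negP[].
  apply: leq_trans (_ : prefix_count (fun x => x < r) t <= r); last first.
    by rewrite prefix_count_lt geq_minl.
  apply: (@leq_prefix_count N _ _ p) => // [|x y xN yN|x xt cx]; first exact: ltnW.
    exact: (pairing_inj pp).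
  have := none x; rewrite mem_iota xt cx /= -ltnNge => -> //=.
  by move: cx; rewrite /opener; have := @pairing_neq N p x pp; lia.
have rN : r < N by have := pairing_lt pp (_ : c < N); lia.
rewrite /opener in ct ot cr cc.
have kN : k < N by lia.
have t1N : t.-1 < N by lia.
have cN : c < N by lia.
have [a1 a2 a3] := pp _ t1N; have [b1 b2 b3] := pp _ kN; have [c1 c2 c3] := pp _ cN.
have [d1 d2 d3] := pp _ rN.
have le : p c <= p t.-1.
  have [->//|ne] := eqVneq c t.-1.
  by apply/ltnW/(nonnesting_mono_closer pp nn) => //; lia.
exists (p r), (p t.-1), k, t; rewrite d3 a3.
have neqr : p c <> r by move=> e; rewrite e in c3; lia.
have jk : p t.-1 < k.
  rewrite ltnNge; apply/negP=> kj.
  have [e|ne] := eqVneq k (p t.-1); first by move: b3 pk; rewrite e a3; lia.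
  by apply: (nn k (p t.-1)); rewrite ?a3; lia.
have pkt : p k < p t by apply: (nonnesting_mono pp nn).
have : p k <> t by move=> e; rewrite e in b3; lia.
have : k <> t.-1 by move=> e; rewrite e in pk; lia.
by have := pairing_lt pp tN; lia.
Qed.

(** Let a < b < c < d be the openers of an occurrence of P4. The first opener
    after [p b] is a late valley, and it is straddled by the arc of [c]. *)
Lemma late_valleys_no_P4 N p : pairing N p -> nonnesting N p ->
  late_valleys_balanced N (opener p) ->
  ~ occurs N p 4 arcs4.
Proof.
move=> pp nn bal /occurrence_P4[a [b [c [d H]]]].
have dd : opener p d by rewrite /opener; lia.
have ca : ~~ opener p (p a) by rewrite /opener (pairingK pp); lia.
have bd : p b < d by lia.
have [t [bt td ot tmin]] := least_from bd dd.
have [r [_ ra cr rmin]] := @least_from (fun x => ~~ opener p x) 0 (p a) (leq0n _) ca.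
have ct : ~~ opener p t.-1.
  have [->|ne] := eqVneq t.-1 (p b); last by apply: tmin; lia.
  by rewrite /opener (pairingK pp); lia.
have vt : valley N (opener p) t by rewrite /valley ct ot; lia.
have init x : x < r -> opener p x by move=> xr; have := rmin x (leq0n _) xr; rewrite negbK.
(* The r arcs of the initial run and the arc of b are closed before t. *)
have lt : r < prefix_count (fun x => ~~ opener p x) t.
  apply: (@leq_trans (prefix_count (fun x => (x < r) || (x == b)) t)).
    rewrite (@prefix_countD1 _ t b) ?eqxx ?orbT //; last lia.
    rewrite ltnS; apply: leq_trans (_ : prefix_count (fun x => x < r) t <= _).
      by rewrite prefix_count_lt; lia.
    rewrite leq_eqVlt; apply/orP; left; apply/eqP; apply: eq_prefix_count => x xt.
    by lia.
  apply: (@leq_prefix_count N _ _ p) => // [|x y xN yN|x xt]; first lia.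
    exact: (pairing_inj pp).
  have xN : x < N by lia.
  move=> xrb; have : x < p x /\ p x <= p b.
    case/orP: xrb => [xr|/eqP->]; last by split; lia.
    have ox := init x xr; split=> //; apply/ltnW/(nonnesting_mono pp nn); rewrite /opener; lia.
  by rewrite /opener (pairingK pp xN); lia.
have e := bal r t init cr vt lt.
have tN : t <= N by lia.
by have := balanced_closed pp tN e (_ : c < t); lia.
Qed.

Definition balanced_word N (w : pred nat) : Prop :=
  dyck_word N w /\ late_valleys_balanced N w.

Lemma dyck_nonnesting N w : dyck_word N w ->
  exists p, [/\ pairing N p, nonnesting N p & forall x, x < N -> w x = opener p x].
Proof.
case=> le e.
have [|q [q1 q2 q3]] := ballot_matching (N := N) (P := w) (Q := fun x => ~~ w x) _ le e.
  by move=> x _ ->.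
have oE x : x < N -> w x = opener q x.
  move=> xN; rewrite /opener; have [wx|wx] := boolP (w x).
    by have [-> _ _ _] := q1 x xN wx.
  by have [] := q2 x xN wx; lia.
exists q; split=> // [x xN|a u au uu uv vN].
  have [wx|wx] := boolP (w x); first by have [] := q1 x xN wx; split; lia.
  by have [] := q2 x xN wx; split; lia.
have := q3 a u au; rewrite !oE /opener; lia.
Qed.

(** * Consecutive valleys in matchings avoiding P2 and P3 *)

Lemma valley_after_closer N (w : pred nat) k d :
  ~~ w k -> w d -> k < d -> d < N -> exists v, [/\ k < v, v <= d & valley N w v].
Proof.
move=> ck od kd dN; have [v [kv vd ov vmin]] := least_from kd od.
exists v; split=> //; rewrite /valley ov andbT; apply/and3P; split; try lia.
by have [->//|ne] := eqVneq v.-1 k; apply: vmin; lia.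
Qed.

Lemma valley_before_run N (w : pred nat) k d :
  ~~ w k -> w d -> k < d -> d < N ->
  exists v, [/\ k < v, v <= d, valley N w v & forall x, v <= x -> x <= d -> w x].
Proof.
move=> ck od kd dN; have [v [kv vd cv vmax]] := @greatest_upto (fun x => ~~ w x) k d (ltnW kd) ck.
have run x : v < x -> x <= d -> w x by move=> vx /(vmax x vx); rewrite negbK.
have vd' : v < d by rewrite ltn_neqAle vd andbT; apply: contraNneq cv => ->.
by exists v.+1; split=> //; rewrite /valley cv run //; lia.
Qed.

Definition consecutive_valleys N (w : pred nat) v v' : Prop :=
  [/\ valley N w v, valley N w v', v < v' & forall x, v < x -> x < v' -> ~~ valley N w x].

(** Between two consecutive valleys the word is a run of U followed by a run
    of D. *)
Lemma consecutive_openers N (w : pred nat) v v' t x :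
  consecutive_valleys N w v v' -> t < v' -> w t -> v <= x -> x <= t -> w x.
Proof.
move=> [vv vv' lt none] tv wt vx xt; apply: contraT => cx.
have xv : x != v by apply: contraNneq cx => ->; case/and4P: vv.
have xt' : x < t by rewrite ltn_neqAle xt andbT; apply: contraNneq cx => ->.
have tN : t < N by case/and4P: vv'; lia.
have [y [xy yt vy]] := valley_after_closer cx wt xt' tN.
by have := none y; rewrite vy; lia.
Qed.

Lemma consecutive_closers N (w : pred nat) v v' t x :
  consecutive_valleys N w v v' -> v <= t -> ~~ w t -> t <= x -> x < v' -> ~~ w x.
Proof.
move=> cv vt ct tx xv; apply/negP=> wx.
by have := consecutive_openers cv xv wx vt tx; rewrite (negPf ct).
Qed.

Lemma next_valley N (w : pred nat) v u : valley N w v -> v < u -> valley N w u ->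
  exists v', consecutive_valleys N w v v' /\ v' <= u.
Proof.
move=> vv vu uu; have [v' [h1 h2 h3 h4]] := least_from vu uu.
by exists v'.
Qed.

Lemma previous_valley N (w : pred nat) v u : valley N w v -> u < v -> valley N w u ->
  exists v', consecutive_valleys N w v' v /\ u <= v'.
Proof.
move=> vv uv uu; have le : u <= v.-1 by lia.
have [v' [h1 h2 h3 h4]] := greatest_upto le uu.
exists v'; split=> //; split=> //; first lia.
by move=> x vx xv; apply: h4 => //; lia.
Qed.

(** For Stoimenow matchings this says that P2 and P3 are avoided, by
    [no_wide_crossingP] and [no_inner_crossingP]. *)
Definition serial_pairing N (p : nat -> nat) : Prop :=
  [/\ stoimenow_pairing N p, no_wide_crossing N p & no_inner_crossing N p].

Definition peaked N (p : nat -> nat) : Prop :=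
  forall v v', consecutive_valleys N (opener p) v v' -> p v = v'.-1.

(** Suppose that v and c = v'-1 are not partners. If v is closed before c, the
    arcs of v and c cross after the closer v-1 and before the opener v',
    against [no_inner_crossing]. If it is closed after c, then c was opened
    before v, and v-1 and v' lie in the gaps of a wide crossing. *)
Lemma serial_peaked N p : pairing N p -> serial_pairing N p -> peaked N p.
Proof.
move=> pp [sp nw ni] v v' cv; have [/and4P[v0 vN cv1 ov] /and4P[v'0 v'N cc ov'] vv' _] := cv.
have cN : v'.-1 < N by lia.
have v1N : v.-1 < N by lia.
have vc : v < v'.-1.
  by rewrite ltn_neqAle; apply/andP; split; [apply: contraNneq cc => <- | lia].
have [y1 y2 y3] := pp v vN; have [x1 x2 x3] := pp _ cN.
have xc : p v'.-1 < v'.-1 by rewrite -(pairing_closer pp).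
have v1c : p v.-1 < v.-1 by rewrite -(pairing_closer pp).
have ox : opener p (p v'.-1) by rewrite /opener x3.
have cy : ~~ opener p (p v) by rewrite /opener y3 -leqNgt ltnW.
have [lt|gt|//] := ltngtP (p v) v'.-1; exfalso.
  have : p (p v) < p v'.-1.
    apply: (closer_run sp) => // x yx xc'; rewrite -(pairing_closer pp); last lia.
    by apply: (consecutive_closers cv) cy yx _; rewrite /opener in ov; lia.
  rewrite y3 => vx.
  have [xy|yx] := ltnP (p v'.-1) (p v).
    by apply: (ni v (p v'.-1) v.-1 v'); rewrite ?x3 //; lia.
  have := consecutive_closers cv (ltnW ov) cy yx; rewrite ox; lia.
have neq : p v <> v' by move=> e; move: cy; rewrite e ov'.
have [xv|vx|e] := ltngtP (p v'.-1) v; last by rewrite e in x3; lia.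
  have neq' : p v'.-1 <> v.-1 by move=> e; rewrite e (negPf cv1) in ox.
  by apply: (nw (p v'.-1) v v.-1 v'); rewrite ?x3 //; lia.
have : p v < p (p v'.-1).
  apply: (opener_run sp) => // x h1 h2.
  by apply: (consecutive_openers cv) ox h1 h2; lia.
lia.
Qed.

(** The opener [a] belongs to the run of openers starting at some valley v. If
    a were not v, the arc of a would cross the peak arc of v, and both have a
    closer before and an opener after. *)
Lemma serial_inner_arc N p a k d : pairing N p -> serial_pairing N p ->
  opener p a -> k < a -> p k < k -> p a < d -> d < N -> opener p d ->
  exists v', consecutive_valleys N (opener p) a v' /\ v' <= d.
Proof.
move=> pp serial oa ka ck ad dN od; have [sp nw ni] := serial.
have aa : a < p a by [].
have aN : a < N by lia.
have paN : p a < N by lia.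
have ck' : ~~ opener p k by rewrite /opener; lia.
have ca : ~~ opener p (p a) by rewrite /opener (pairingK pp); lia.
have [v [kv va vv run]] := valley_before_run ck' oa ka aN.
have [u [au ud uu]] := valley_after_closer ca od ad dN.
have vu : v < u by lia.
have [v' [cv v'u]] := next_valley vv vu uu.
have [ev|ne] := eqVneq v a; first by exists v'; rewrite -ev; split=> //; lia.
have va' : v < a by lia.
have pv := serial_peaked pp serial cv.
have lt : p v < p a by apply: (opener_run sp va' aN run).
have vN : v < N by lia.
have nva : a < v'.
  rewrite ltnNge; apply/negP=> v'a; have [_ /and4P[_ _ c _] vv' _] := cv.
  have : opener p v'.-1 by apply: run; lia.
  by rewrite (negPf c).
have apv : a <> p v by move=> e; move: oa; rewrite /opener e (pairingK pp vN); lia.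
exfalso; case/and4P: vv => v0 _ cv1 ov.
apply: (ni v a v.-1 d) => //; try lia.
by rewrite -(pairing_closer pp) //; lia.
Qed.

Definition wide_word N (w : pred nat) : Prop :=
  exists a b c d, [/\ a < b, b.+1 < c, c.+1 < d & d < N] /\
   [/\ ~~ w a, w b && w b.+1, ~~ w c && ~~ w c.+1 & w d].

(** The second U of a factor UU preceded by D is no valley, so by
    [serial_inner_arc] no opener comes after its arc. Likewise no closer comes
    before the arc of the first D of a factor DD followed by U. With UU before
    DD these two arcs form a wide crossing. *)
Lemma serial_not_wide N p : pairing N p -> serial_pairing N p ->
  ~ wide_word N (opener p).
Proof.
move=> pp serial [a [b [c [d [[ab bc cd dN] [ca /andP[ob ob1] /andP[cc cc1] od]]]]]].
have [sp nw ni] := serial.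
have b1N : b.+1 < N by lia.
have cN : c < N by lia.
have pcN := pairing_lt pp cN; have pcK := pairingK pp cN.
have aN : a < N by lia.
have pc : p c < c by rewrite -(pairing_closer pp).
have pa : p a < a by rewrite -(pairing_closer pp).
have right : d <= p b.+1.
  rewrite leqNgt; apply/negP=> lt.
  have [|v' [[/and4P[_ _ h _] _ _ _] _]] := serial_inner_arc pp serial ob1 (ltnW _ : a < b.+1) pa lt dN od.
    by [].
  by rewrite /= ob in h.
have left : p c <= a.
  rewrite leqNgt; apply/negP=> lt; have opc : opener p (p c) by rewrite /opener pcK.
  have cd' : p (p c) < d by rewrite pcK; lia.
  have [v' [cv v'd]] := serial_inner_arc pp serial opc lt pa cd' dN od.
  have := serial_peaked pp serial cv; rewrite pcK => e.
  by case: cv => _ /and4P[? _ _ h] _ _; move: cc1 h; rewrite e prednK // => /negP.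
have neq : p c <> a by move=> e; rewrite e in pcK; lia.
have neq' : p b.+1 <> d.
  by move=> e; have := pairingK pp b1N; rewrite e => e'; rewrite /opener e' in od; lia.
have pbN := pairing_lt pp b1N.
apply: (nw (p c) b.+1 a d) => //; rewrite ?pcK; lia.
Qed.

(** * Peak arcs *)

Definition valley_before N w t := has (fun v => (v < t) && valley N w v) (iota 0 N).
Definition valley_from N w t := has (fun v => (t <= v) && valley N w v) (iota 0 N).

Lemma valley_beforeP N w t :
  reflect (exists2 v, v < t & valley N w v) (valley_before N w t).
Proof.
apply: (iffP hasP) => [[v _ /andP[]]|[v vt vv]]; first by exists v.
by exists v; rewrite ?vt // mem_iota; case/and4P: vv.
Qed.

Lemma valley_fromP N w t :
  reflect (exists2 v, t <= v & valley N w v) (valley_from N w t).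
Proof.
apply: (iffP hasP) => [[v _ /andP[]]|[v vt vv]]; first by exists v.
by exists v; rewrite ?vt // mem_iota; case/and4P: vv.
Qed.

Definition peak_opener N w x := valley N w x && valley_from N w x.+1.
Definition peak_closer N w x := valley N w x.+1 && valley_before N w x.+1.
(** The ends of the arcs that [serial_peaked] imposes. *)
Definition peak_point N w x := peak_opener N w x || peak_closer N w x.

Lemma eq_valley N (w w' : pred nat) t :
  (forall x, x < N -> w x = w' x) -> valley N w t = valley N w' t.
Proof.
move=> e; rewrite /valley; have [tN|] := ltnP t N; last by rewrite andbF.
by rewrite !e //; lia.
Qed.

Lemma eq_peak_point N (w w' : pred nat) x :
  (forall x, x < N -> w x = w' x) -> peak_point N w x = peak_point N w' x.
Proof.
move=> e; rewrite /peak_point /peak_opener /peak_closer !(eq_valley _ e).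
by congr (_ && _ || _ && _); apply: eq_has => v; rewrite (eq_valley _ e).
Qed.

Lemma eq_consecutive_valleys N (w w' : pred nat) v v' :
  (forall x, x < N -> w x = w' x) ->
  consecutive_valleys N w v v' -> consecutive_valleys N w' v v'.
Proof.
move=> e [h1 h2 h3 h4]; split; rewrite -?(eq_valley _ e) // => x vx xv.
by rewrite -(eq_valley _ e) h4.
Qed.

Lemma peak_pointE N (w : pred nat) x : peak_point N w x ->
  exists v v', consecutive_valleys N w v v' /\ (x = v \/ x = v'.-1).
Proof.
case/orP=> /andP[vx].
  case/valley_fromP=> u xu vu; have [v' [cv _]] := next_valley vx xu vu.
  by exists x, v'; split; [|left].
case/valley_beforeP=> u xu vu; have [v [cv _]] := previous_valley vx xu vu.
by exists v, x.+1; split; [|right].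
Qed.

Lemma peak_point_ends N (w : pred nat) v v' : consecutive_valleys N w v v' ->
  peak_opener N w v /\ peak_closer N w v'.-1.
Proof.
case=> vv vv' lt _; have v'0 : 0 < v' by lia.
rewrite /peak_opener /peak_closer prednK // vv vv'; split.
  by apply/valley_fromP; exists v'.
by apply/valley_beforeP; exists v.
Qed.

Lemma peaked_point N p x : pairing N p -> peaked N p ->
  peak_point N (opener p) x -> peak_point N (opener p) (p x).
Proof.
move=> pp pk /peak_pointE[v [v' [cv ex]]]; have pv := pk _ _ cv.
have [h1 h2] := peak_point_ends cv; have [/and4P[_ vN _ _] _ _ _] := cv.
rewrite /peak_point; case: ex => ->; first by rewrite pv h2 orbT.
by rewrite -pv (pairingK pp vN) h1.
Qed.

Lemma peaked_eq N p q x : pairing N p -> pairing N q ->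
  peaked N p -> peaked N q -> (forall x, x < N -> opener p x = opener q x) ->
  peak_point N (opener p) x -> p x = q x.
Proof.
move=> pp pq kp kq e /peak_pointE[v [v' [cv ex]]].
have pv := kp _ _ cv; have qv := kq _ _ (eq_consecutive_valleys e cv).
have [/and4P[_ vN _ _] _ _ _] := cv.
case: ex => ->; first by rewrite pv qv.
by rewrite -{1}pv -qv !(pairingK pp, pairingK pq).
Qed.

(** By [nested_gaps], the inner arc of a nesting has a closer before it and an
    opener after it, so it is a peak arc. *)
Lemma serial_nonnesting_off N p : pairing N p -> serial_pairing N p ->
  nonnesting_off N (peak_point N (opener p)) p.
Proof.
move=> pp serial a u _ Su au uu ua aN; have [sp _ _] := serial.
have [[k [ak ku kk]] [d [ud da dd]]] := nested_gaps pp sp au uu ua aN.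
have dN : d < N by lia.
have [v' [cv _]] := serial_inner_arc pp serial uu ku kk ud dN dd.
by case/negP: Su; have [h _] := peak_point_ends cv; rewrite /peak_point h.
Qed.

Lemma serial_unique N p q : pairing N p -> pairing N q ->
  serial_pairing N p -> serial_pairing N q ->
  (forall x, x < N -> opener p x = opener q x) ->
  forall x, x < N -> p x = q x.
Proof.
move=> pp pq sp sq e; have [kp kq] := (serial_peaked pp sp, serial_peaked pq sq).
apply: (nonnesting_unique (S := peak_point N (opener p))) => //.
- by move=> x xN Sx; split; [apply: peaked_eq Sx | apply: peaked_point].
- exact: serial_nonnesting_off.
- move=> a u; rewrite !(eq_peak_point _ e); exact: serial_nonnesting_off.
Qed.

(** If o < c, there is a valley at or before [o] and another one after [c]. Hence
    [o], not being a peak point, is no valley: it ends a factor UU. Similarly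
    [c] starts a factor DD. *)
Lemma outer_closer_before_opener N (w : pred nat) o c t d :
  ~ wide_word N w -> ~~ peak_point N w o -> ~~ peak_point N w c ->
  w o -> ~~ w t -> t < o -> ~~ w c -> w d -> c < d -> d < N -> c < o.
Proof.
move=> nw So Sc wo wt to wc wd cd dN; rewrite ltnNge; apply/negP=> oc.
have oc' : o < c by rewrite ltn_neqAle oc andbT; apply: contraNneq wc => <-.
have oN : o < N by lia.
have [x [tx xo vx]] := valley_after_closer wt wo to oN.
have [y [cy yd vy]] := valley_after_closer wc wd cd dN.
have o1 : w o.-1.
  apply: contraT => co1; case/negP: So; rewrite /peak_point /peak_opener.
  have -> : valley N w o by rewrite /valley co1 wo oN; lia.
  by have -> : valley_from N w o.+1 by apply/valley_fromP; exists y => //; lia.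
have c1 : ~~ w c.+1.
  apply/negP=> oc1; case/negP: Sc; rewrite /peak_point /peak_closer.
  have -> : valley N w c.+1 by rewrite /valley wc oc1; lia.
  have -> : valley_before N w c.+1 by apply/valley_beforeP; exists x => //; lia.
  by rewrite orbT.
case: nw; exists t, o.-1, c, d.
have neq : t != o.-1 by apply: contraNneq wt => ->.
have neq' : c.+1 != d by apply: contraNneq c1 => ->.
have o0 : 0 < o by apply: leq_ltn_trans to.
rewrite prednK // wo o1 wc c1 wt wd; split=> //; split=> //.
  by rewrite ltn_neqAle neq -ltnS prednK.
by rewrite ltn_neqAle neq'.
Qed.

Section Converse.

Variables (N : nat) (p : nat -> nat).
Hypotheses (pp : pairing N p) (pk : peaked N p).
Hypothesis nn : nonnesting_off N (peak_point N (opener p)) p.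
Hypothesis nw : ~ wide_word N (opener p).

Let S := peak_point N (opener p).

Lemma peak_pointN x : x < N -> S (p x) = S x.
Proof.
move=> xN; apply/idP/idP; last exact: peaked_point.
by move/(peaked_point pp pk); rewrite (pairingK pp).
Qed.

(** Otherwise both ends of the arc of [o] would be subject to
    [outer_closer_before_opener], which puts [p o] before [o]. *)
Lemma outer_opener o t d : opener p o -> ~~ S o -> ~~ opener p t -> t < o ->
  p o < d -> d < N -> ~~ opener p d.
Proof.
move=> oo So ct to od dN; apply/negP=> dd; have oN : o < N by rewrite /opener in oo; lia.
have cpo : ~~ opener p (p o) by rewrite /opener (pairingK pp oN) -leqNgt ltnW.
have Spo : ~~ S (p o) by rewrite peak_pointN.
have := outer_closer_before_opener nw So Spo oo ct to cpo dd od dN.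
by rewrite /opener in oo; lia.
Qed.

Lemma outer_closer c t d : ~~ opener p c -> ~~ S c -> opener p d -> c < d -> d < N ->
  t < p c -> opener p t.
Proof.
move=> cc Sc dd cd dN tc; apply: contraT => ct; have cN : c < N by lia.
have lt : p c < c by rewrite -(pairing_closer pp).
have opc : opener p (p c) by rewrite /opener (pairingK pp cN).
have Spc : ~~ S (p c) by rewrite peak_pointN.
have := outer_closer_before_opener nw Spc Sc opc ct tc cc dd cd dN.
lia.
Qed.

Lemma peak_arc x : opener p x -> S x -> x < N ->
  exists v', consecutive_valleys N (opener p) x v' /\ p x = v'.-1.
Proof.
move=> ox /peak_pointE[v [v' [cv [->|e]]]] xN; first by exists v'; rewrite (pk cv).
by have [_ /and4P[_ _ h _] _ _] := cv; rewrite e (negPf h) in ox.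
Qed.

(** Of two adjacent openers only the first one can be a valley. Its peak arc ends
    before an opener, unlike the arc of the second one. The case of closers is
    symmetric. *)
Lemma peaked_stoimenow : stoimenow_pairing N p.
Proof.
split=> [i iN oi oi'|j jN cj cj'].
  have neq : p i <> p i.+1 by move/(pairing_inj pp); lia.
  have [i1N i2N] := (pairing_lt pp (ltnW iN), pairing_lt pp iN).
  have S1 : ~~ S i.+1.
    apply/negP=> /(peak_arc oi')/(_ iN)[v' [[/and4P[_ _ h _] _ _ _] _]].
    by rewrite /= /opener oi in h.
  have [Si|Si] := boolP (S i); last by have := nn Si S1; lia.
  have [v' [[vi vv' lt _] e]] := peak_arc oi Si (ltnW iN).
  case/and4P: vi vv' => i0 _ ci1 _ /and4P[v0 v'N cv' ov'].
  have lt1 : i.-1 < i.+1 by lia.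
  have [le|//] := leqP (p i.+1) (p i); exfalso.
  have := outer_opener oi' S1 ci1 lt1 _ v'N; rewrite ov'; lia.
have neq : p j <> p j.+1 by move/(pairing_inj pp); lia.
have jN' := ltnW jN.
have [p1 p2] := (pairingK pp jN', pairingK pp jN).
have [q1 q2] := (pairing_lt pp jN', pairing_lt pp jN).
have oj : opener p (p j) by rewrite /opener p1.
have oj' : opener p (p j.+1) by rewrite /opener p2.
have cjj : ~~ opener p j by rewrite /opener; lia.
have cjj' : ~~ opener p j.+1 by rewrite /opener; lia.
have S1 : ~~ S j.
  rewrite -peak_pointN //; apply/negP=> /(peak_arc oj)/(_ q1)[v' [[_ /and4P[v0 _ _ h] _ _]]].
  by rewrite p1 => e; rewrite e prednK // h in cjj'.
have [Sj|Sj] := boolP (S j.+1); last first.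
  have [Sj' S1'] : ~~ S (p j.+1) /\ ~~ S (p j) by rewrite !peak_pointN.
  by have := nn Sj' S1'; rewrite p1 p2; lia.
rewrite -peak_pointN // in Sj; have [v' [[vi vv' lt _] e]] := peak_arc oj' Sj q2.
case/and4P: vi vv' => i0 _ ci1 _ /and4P[v0 v'N cv' ov'].
rewrite p2 in e; have [le|//] := leqP (p j.+1) (p j); exfalso.
have jv : j < v' by lia.
have := outer_closer cjj S1 ov' jv v'N (_ : (p j.+1).-1 < _); rewrite (negPf ci1).
lia.
Qed.

(** In a forbidden crossing a peak arc would contain a valley between its ends.
    For arcs that are not peak arcs, [outer_closer_before_opener] excludes the
    wide crossing and [outer_opener] the inner one. *)
Lemma peaked_serial : serial_pairing N p.
Proof.
split; first exact: peaked_stoimenow.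
- move=> x i k d xk ki ix xd di iN kk dd.
  have ck : ~~ opener p k by rewrite /opener; lia.
  have [xN i'N dN] : [/\ x < N, i < N & d < N] by split; lia.
  have [Kx Ki] := (pairingK pp xN, pairingK pp i'N).
  have oi : opener p i by rewrite /opener; lia.
  have ox : opener p x by rewrite /opener; lia.
  have cx : ~~ opener p (p x) by rewrite /opener; lia.
  have [Sx|Sx] := boolP (S x).
    have [v' [[_ _ _ none] e]] := peak_arc ox Sx xN.
    have [y [ky yi vy]] := valley_after_closer ck oi ki i'N.
    by have := none y; rewrite vy; lia.
  have [Si|Si] := boolP (S i).
    have [v' [[_ _ _ none] e]] := peak_arc oi Si i'N.
    have [y [ky yi vy]] := valley_after_closer cx dd xd dN.
    by have := none y; rewrite vy; lia.
  have Spx : ~~ S (p x) by rewrite peak_pointN.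
  have := outer_closer_before_opener nw Si Spx oi ck ki cx dd xd dN; lia.
- move=> a b k d ka ab ba papb bd dN kk dd.
  have ck : ~~ opener p k by rewrite /opener; lia.
  have [aN bN paN] : [/\ a < N, b < N & p a < d] by split; lia.
  have oa : opener p a by rewrite /opener; lia.
  have ob : opener p b by rewrite /opener; lia.
  have [Sa|Sa] := boolP (S a); last first.
    by have := outer_opener oa Sa ck ka paN dN; rewrite /opener dd.
  have [Sb|Sb] := boolP (S b); last first.
    by have := outer_opener ob Sb ck (ltn_trans ka ab) bd dN; rewrite /opener dd.
  have [v' [[_ _ _ none] e]] := peak_arc oa Sa aN.
  have [u [[vb _ _ _] _]] := peak_arc ob Sb bN.
  by have := none b; rewrite vb; lia.
Qed.

End Converse.

(** * Existence of a matching with prescribed peak arcs *)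

Lemma valley_beforeS N w t :
  valley_before N w t.+1 = valley_before N w t || valley N w t.
Proof.
apply/valley_beforeP/orP => [[v]|[/valley_beforeP[v vt vv]|vt]].
- rewrite ltnS leq_eqVlt => /orP[/eqP->|vt vv]; [by right | left].
  by apply/valley_beforeP; exists v.
- by exists v => //; lia.
- by exists t.
Qed.

Lemma valley_fromS N w t :
  valley_from N w t = valley N w t || valley_from N w t.+1.
Proof.
apply/valley_fromP/orP => [[v]|[vt|/valley_fromP[v vt vv]]].
- rewrite leq_eqVlt => /orP[/eqP->|vt vv]; [by left | right].
  by apply/valley_fromP; exists v.
- by exists t.
- by exists v => //; lia.
Qed.

Lemma valleyS N w t : valley N w t -> valley N w t.+1 = false.
Proof. by case/and4P=> _ _ _ wt; rewrite /valley /= wt andbF. Qed.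

Definition inside_peak N w t :=
  [&& valley_before N w t, valley_from N w t & ~~ valley N w t].

(** Peak arcs are disjoint, so at most one of them is open at a given point. *)
Lemma peak_openers_closers N (w : pred nat) t :
  prefix_count (peak_opener N w) t =
  prefix_count (peak_closer N w) t + inside_peak N w t.
Proof.
elim: t => [|t IH].
  rewrite /inside_peak; have -> : valley_before N w 0 = false by apply/valley_beforeP=> -[].
  by [].
rewrite !prefix_countS IH -!addnA; congr (_ + _).
rewrite /inside_peak /peak_opener /peak_closer valley_beforeS (valley_fromS _ _ t).
rewrite (valley_fromS _ _ t.+1).
have := @valleyS N w t.
case: (valley N w t) => [->//|_].
  by case: (valley_from N w t.+2); case: (valley_before N w t).
by case: (valley N w t.+1); case: (valley_before N w t); case: (valley_from N w t.+2).
Qed.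

(** If the height at [t] were 0, the previous letter would be D and the next one
    U, and [t] would be a valley. *)
Lemma inside_peak_height N (w : pred nat) t : dyck_word N w -> t <= N ->
  inside_peak N w t -> prefix_count (fun x => ~~ w x) t < prefix_count w t.
Proof.
case=> le _ tN /and3P[/valley_beforeP[u ut _] /valley_fromP[v tv vv] nv].
have vN : v < N by case/and4P: vv.
have [s ts] : exists s, t = s.+1 by exists t.-1; lia.
have s2N : s.+1 < N by lia.
have := le s (ltnW (ltnW s2N)); have := le s.+2 s2N; move: nv.
rewrite ts !prefix_countS /valley s2N /=.
by case: (w s); case: (w s.+1) => /=; lia.
Qed.

Lemma prefix_countD (P Q : pred nat) t :
  prefix_count P t =
  prefix_count (fun x => P x && ~~ Q x) t + prefix_count (fun x => P x && Q x) t.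
Proof.
elim: t => // t IH; rewrite !prefix_countS IH.
by case: (P t); case: (Q t) => /=; lia.
Qed.

Lemma peak_pointP N (w : pred nat) x : 
  (w x && peak_point N w x = peak_opener N w x) /\
  (~~ w x && peak_point N w x = peak_closer N w x).
Proof.
rewrite /peak_point /peak_opener /peak_closer /valley /=.
by case: (w x); rewrite ?andbF ?andbT ?orbF ?andFb.
Qed.

(** Induction on v. If the closer v'-1 were not matched with v, its opener would
    be an earlier valley u, but u is matched before the next valley after it. *)
Lemma mated_peaks N (w : pred nat) (p : nat -> nat) :
  (forall x, x < N -> w x -> [/\ x < p x, p x < N, ~~ w (p x),
    p (p x) = x & peak_point N w (p x) = peak_point N w x]) ->
  (forall x, x < N -> ~~ w x -> [/\ p x < x, w (p x),
    p (p x) = x & peak_point N w (p x) = peak_point N w x]) ->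
  forall v v', consecutive_valleys N w v v' -> p v = v'.-1.
Proof.
move=> up down v v'.
elim/ltn_ind: v v' => v IH v' cv; have [vv vv' lt none] := cv.
have [/and4P[_ vN _ wv] /and4P[v'0 v'N wc _]] := (vv, vv').
have [po pc] := peak_point_ends cv.
have Sv : peak_point N w v by rewrite /peak_point po.
have [h1 h2 h3 h4 h5] := up v vN wv.
have ge : v'.-1 <= p v.
  have [_ q] := peak_pointP N w (p v); move: q; rewrite h3 h5 Sv => /esym/andP[vp _].
  rewrite leqNgt; apply/negP; rewrite ltn_predRL => /(none _ (leqW h1)).
  by rewrite vp.
apply/eqP; rewrite eqn_leq ge andbT leqNgt; apply/negP=> gt.
have cN : v'.-1 < N by apply: leq_ltn_trans v'N; apply: leq_pred.
have Sc : peak_point N w v'.-1 by rewrite /peak_point pc orbT.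
have [k1 k2 k3 k4] := down _ cN wc.
have uv : p v'.-1 < v.
  rewrite ltnNge; apply/negP; rewrite leq_eqVlt => /orP[/eqP ev|vu].
    by move: gt; rewrite {1}ev k3 ltnn.
  have [q _] := peak_pointP N w (p v'.-1); move: q; rewrite k2 k4 Sc => /esym/andP[vp _].
  by have := none _ vu (leq_trans k1 (leq_pred v')); rewrite vp.
have [q _] := peak_pointP N w (p v'.-1); move: q; rewrite k2 k4 Sc => /esym/andP[vp _].
have [u' [cu uv']] := next_valley vp uv vv.
have := IH _ uv _ cu; rewrite k3 => e.
by move: uv uv' lt e; clear; lia.
Qed.

(** Peak openers are matched with peak closers, and the other letters with each
    other. The latter satisfy the ballot condition because an open peak arc uses
    one unit of a height which is positive by [inside_peak_height]. *)
Lemma dyck_peaked N w : dyck_word N w ->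
  exists p, [/\ pairing N p, peaked N p,
    nonnesting_off N (peak_point N (opener p)) p & forall x, x < N -> w x = opener p x].
Proof.
move=> dw; have [le e] := dw.
have insideN : inside_peak N w N = false.
  apply/and3P=> -[_ /valley_fromP[v Nv /and4P[_ vN _ _]] _]; lia.
have inner t : prefix_count (fun x => w x && peak_point N w x) t =
    prefix_count (fun x => ~~ w x && peak_point N w x) t + inside_peak N w t.
  transitivity (prefix_count (peak_opener N w) t).
    by apply: eq_prefix_count => x _; case: (peak_pointP N w x).
  rewrite peak_openers_closers; congr (_ + _).
  by apply: eq_prefix_count => x _; case: (peak_pointP N w x).
have split1 t := prefix_countD w (peak_point N w) t.
have split2 t := prefix_countD (fun x => ~~ w x) (peak_point N w) t.
have [| | |s [s1 s2 s3]] := @ballot_matching N (fun x => w x && peak_point N w x)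
  (fun x => ~~ w x && peak_point N w x).
- by move=> x _ /andP[->].
- by move=> t _; rewrite inner leq_addr.
- by rewrite inner insideN addn0.
have [| | |r [r1 r2 r3]] := @ballot_matching N (fun x => w x && ~~ peak_point N w x)
  (fun x => ~~ w x && ~~ peak_point N w x).
- by move=> x _ /andP[->].
- move=> t tN; have := inner t; have := split1 t; have := split2 t; have := le t tN.
  by case: (boolP (inside_peak N w t)) => [/(inside_peak_height dw tN)|_]; lia.
- have := inner N; have := split1 N; have := split2 N; rewrite insideN e; lia.
pose p x := if peak_point N w x then s x else r x.
have pS x : peak_point N w x -> p x = s x by rewrite /p => ->.
have pR x : ~~ peak_point N w x -> p x = r x by rewrite /p => /negPf->.
have up x : x < N -> w x -> [/\ x < p x, p x < N, ~~ w (p x),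
    p (p x) = x & peak_point N w (p x) = peak_point N w x].
  move=> xN wx; have [Sx|Sx] := boolP (peak_point N w x).
    have [] := s1 x xN; rewrite ?wx // => h1 h2 /andP[h3 h4] h5.
    by rewrite pS // h4 pS.
  have [] := r1 x xN; rewrite ?wx // => h1 h2 /andP[h3 h4] h5.
  by rewrite pR // (negPf h4) pR.
have down x : x < N -> ~~ w x -> [/\ p x < x, w (p x),
    p (p x) = x & peak_point N w (p x) = peak_point N w x].
  move=> xN wx; have [Sx|Sx] := boolP (peak_point N w x).
    have [] := s2 x xN; rewrite ?wx // => h1 /andP[h3 h4] h5.
    by rewrite pS // h4 pS.
  have [] := r2 x xN; rewrite ?wx // => h1 /andP[h3 h4] h5.
  by rewrite pR // (negPf h4) pR.
have pp : pairing N p.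
  move=> x xN; have [wx|wx] := boolP (w x).
    by have [] := up x xN wx; split; lia.
  by have [] := down x xN wx; split; lia.
have oE x : x < N -> w x = opener p x.
  move=> xN; rewrite /opener; have [wx|wx] := boolP (w x).
    by have [->] := up x xN wx.
  by have [] := down x xN wx; lia.
have oE' x : x < N -> opener p x = w x by move=> xN; rewrite oE.
exists p; split=> // [v v' /(eq_consecutive_valleys oE')|a u].
  exact: mated_peaks.
rewrite !(eq_peak_point _ oE') => Sa Su au uu ua aN.
have [a1 a2] : a < N /\ u < N by lia.
have wu : w u by rewrite oE // /opener.
have wa : w a by rewrite oE // /opener; lia.
have := r3 a u au a2; rewrite wa wu Sa Su -!pR // => /(_ isT isT); lia.
Qed.

(** * Counting Dyck words with an automaton *)

Definition accepted_words (W : pred (seq bool)) l : nat :=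
  #|[set t : l.-tuple bool | W t]|.

Lemma accepted_words0 W : accepted_words W 0 = W [::].
Proof.
rewrite /accepted_words; have [w|w] := boolP (W [::]).
  rewrite (_ : [set _ | _] = [set: 0.-tuple bool]) ?cardsT ?card_tuple //.
  by apply/setP=> t; rewrite !inE tuple0.
by apply/eqP; rewrite cards_eq0; apply/eqP/setP=> t; rewrite !inE tuple0 (negPf w).
Qed.

Lemma accepted_wordsS W l : accepted_words W l.+1 =
  accepted_words (fun s => W (true :: s)) l + accepted_words (fun s => W (false :: s)) l.
Proof.
rewrite /accepted_words.
set A := [set t | W (true :: _)]; set B := [set t | W (false :: _)].
have injc b : injective (fun t : l.-tuple bool => [tuple of b :: t]).
  by move=> t t' /(congr1 val) [] /val_inj.
rewrite -(card_imset A (injc true)) -(card_imset B (injc false)) -cardsUI.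
rewrite [X in _ = _ + X](_ : _ = 0); last first.
  apply/eqP; rewrite cards_eq0; apply/eqP/setP=> t; rewrite !inE.
  by apply/negP=> /andP[/imsetP[u _ ->] /imsetP[v _ /(congr1 val)]].
rewrite addn0; congr #|pred_of_set _|; apply/setP=> t; rewrite !inE.
apply/idP/orP => [|[] /imsetP[u]]; rewrite ?inE => //; try by move=> ? ->.
case/tupleP: t => -[] t wt; [left | right]; apply/imsetP; exists t; rewrite ?inE //.
Qed.

Lemma accepted_words_eq (W W' : pred (seq bool)) l :
  (forall s, size s = l -> W s = W' s) -> accepted_words W l = accepted_words W' l.
Proof.
move=> e; rewrite /accepted_words; congr #|pred_of_set _|; apply/setP=> t.
by rewrite !inE e // size_tuple.
Qed.

(** Reads a word from height [h]. A letter D needs a positive height; a letter U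
    needs the permission of the automaton. *)
Fixpoint accepts (Q : Type) (up down : Q -> Q) (allowed : Q -> nat -> bool) (q : Q) (h : nat)
    (s : seq bool) : bool :=
  match s with
  | [::] => h == 0
  | true :: s' => allowed q h && accepts up down allowed (up q) h.+1 s'
  | false :: s' => (0 < h) && accepts up down allowed (down q) h.-1 s'
  end.

Fixpoint state_at (Q : Type) (up down : Q -> Q) (q : Q) (w : pred nat) (t : nat) : Q :=
  if t is t'.+1 then
    (if w t' then up else down) (state_at up down q w t')
  else q.

Lemma state_at_cons (Q : Type) (up down : Q -> Q) q b s t :
  state_at up down q (letter (b :: s)) t.+1 =
  state_at up down (if b then up q else down q) (letter s) t.
Proof. by elim: t => [|t /= <-] //=; case: b. Qed.

Lemma prefix_count_cons (f : bool -> bool) b s t :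
  prefix_count (fun x => f (letter (b :: s) x)) t.+1 =
  f b + prefix_count (fun x => f (letter s x)) t.
Proof.
elim: t => [|t IH]; first by rewrite /prefix_count /= addn0.
by rewrite prefix_countS IH prefix_countS addnA.
Qed.

Lemma acceptsP (Q : Type) (up down : Q -> Q) allowed q h s :
  accepts up down allowed q h s <->
  [/\ forall t, t <= size s ->
        prefix_count (fun x => ~~ letter s x) t <= h + prefix_count (letter s) t,
      prefix_count (fun x => ~~ letter s x) (size s) = h + prefix_count (letter s) (size s) &
      forall t, t < size s -> letter s t ->
        allowed (state_at up down q (letter s) t)
          (h + prefix_count (letter s) t - prefix_count (fun x => ~~ letter s x) t)].
Proof.
have cU b s' t : prefix_count (letter (b :: s')) t.+1 = b + prefix_count (letter s') t.
  exact: (prefix_count_cons id).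
have cD b s' t := prefix_count_cons negb b s' t.
elim: s q h => [|b s IH] q h /=.
  split=> [/eqP->|[_]]; last by rewrite /prefix_count /=; lia.
  by split=> // t; rewrite leqn0 => /eqP->.
case: b; split.
- case/andP=> al /IH[h1 h2 h3]; split.
  + by case=> // t /h1; rewrite cU cD /=; lia.
  + by rewrite cU cD h2 /=; lia.
  + case=> [_ _|t ts]; first by rewrite /prefix_count /= addn0 subn0.
    rewrite [letter _ _]/(letter s t) => /(h3 t ts).
    rewrite state_at_cons cU cD /=.
    by rewrite (_ : h + (true + _) = h.+1 + prefix_count (letter s) t) //; lia.
- case=> h1 h2 h3; apply/andP; split.
    by have := h3 0 isT isT; rewrite /prefix_count /= addn0 subn0.
  apply/IH; split.
  + by move=> t /(h1 t.+1); rewrite cU cD /=; lia.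
  + by move: h2; rewrite cU cD /=; lia.
  + move=> t ts wt; have := h3 t.+1 ts wt; rewrite state_at_cons cU cD /=.
    by rewrite (_ : h + (true + _) = h.+1 + prefix_count (letter s) t) //; lia.
- case/andP=> h0 /IH[h1 h2 h3]; split.
  + by case=> // t /h1; rewrite cU cD /=; lia.
  + by rewrite cU cD h2 /=; lia.
  + case=> [_ //|t ts].
    rewrite [letter _ _]/(letter s t) => /(h3 t ts).
    rewrite state_at_cons cU cD /=.
    by rewrite (_ : _ - (1 + _) = h.-1 + prefix_count (letter s) t -
       prefix_count (fun x => ~~ letter s x) t) //; lia.
- case=> h1 h2 h3; have h0 : 0 < h.
    by have := h1 1 isT; rewrite cU cD /prefix_count /=; lia.
  rewrite h0; apply/IH; split.
  + by move=> t /(h1 t.+1); rewrite cU cD /=; lia.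
  + by move: h2; rewrite cU cD /=; lia.
  + move=> t ts wt; have := h3 t.+1 ts wt; rewrite state_at_cons cU cD /=.
    by rewrite (_ : _ - (1 + _) = h.-1 + prefix_count (letter s) t -
       prefix_count (fun x => ~~ letter s x) t) //; lia.
Qed.

Lemma dyck_acceptsP (Q : Type) (up down : Q -> Q) allowed q s :
  accepts up down allowed q 0 s <->
  dyck_word (size s) (letter s) /\
  forall t, t < size s -> letter s t ->
    allowed (state_at up down q (letter s) t)
      (prefix_count (letter s) t - prefix_count (fun x => ~~ letter s x) t).
Proof. by rewrite acceptsP; split=> [[? ? ?]|[[? ?] ?]]. Qed.

(** The number of ways to go on with [k] letters U, hence [h + k] letters D. *)
Definition completions (Q : Type) (up down : Q -> Q) allowed (q : Q) h k : nat :=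
  accepted_words (accepts up down allowed q h) (h + k.*2).

Lemma accepts_size (Q : Type) (up down : Q -> Q) allowed q h s :
  accepts up down allowed q h s -> h <= size s.
Proof.
elim: s q h => [|[] s IH] q h /=; first by move/eqP->.
  by case/andP=> _ /IH; lia.
by case/andP=> h0 /IH; lia.
Qed.

Lemma accepted_words_false (W : pred (seq bool)) l :
  (forall s, size s = l -> W s = false) -> accepted_words W l = 0.
Proof.
move=> e; rewrite (@accepted_words_eq _ pred0 _ e) /accepted_words.
by apply/eqP; rewrite cards_eq0; apply/eqP/setP=> t; rewrite !inE.
Qed.

Section Completions.
Variables (Q : Type) (up down : Q -> Q) (allowed : Q -> nat -> bool).
Let c := completions up down allowed.

Lemma completions0 q h : c q h 0 = 1.
Proof.
elim: h q => [|h IH] q; rewrite /c /completions /=; first by rewrite accepted_words0.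
rewrite addn0 accepted_wordsS accepted_words_false /= => [|s sz].
  by rewrite add0n -[RHS](IH (down q)) /c /completions addn0.
by apply/negP=> /andP[_ acc]; have := accepts_size acc; rewrite sz; lia.
Qed.

Lemma completionsS q h k : c q h k.+1 =
  (if allowed q h then c (up q) h.+1 k else 0) +
  (if 0 < h then c (down q) h.-1 k.+1 else 0).
Proof.
rewrite {1}/c /completions doubleS !addnS accepted_wordsS /=; congr (_ + _).
  by case: ifP => al; [rewrite -addSn | apply: accepted_words_false => s _].
case: ifP => h0; last exact: accepted_words_false.
by rewrite /c /completions; congr accepted_words; lia.
Qed.

End Completions.

(** * The two automata *)

Definition pair_before (P : pred nat) t := has (fun b => (b.+1 < t) && P b) (iota 0 t).

Lemma pair_beforeP (P : pred nat) t :
  reflect (exists2 b, b.+1 < t & P b) (pair_before P t).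
Proof.
apply: (iffP hasP) => [[b _ /andP[]]|[b bt Pb]]; first by exists b.
by exists b; rewrite ?bt // mem_iota; lia.
Qed.

Lemma pair_beforeS (P : pred nat) t :
  pair_before P t.+2 = pair_before P t.+1 || P t.
Proof.
apply/pair_beforeP/orP => [[b]|[/pair_beforeP[b bt Pb]|Pt]].
- rewrite !ltnS leq_eqVlt => /orP[/eqP->|bt Pb]; [by right | left].
  by apply/pair_beforeP; exists b.
- by exists b => //; lia.
- by exists t.
Qed.

Lemma pair_before_small (P : pred nat) t : t < 2 -> pair_before P t = false.
Proof. by move=> t2; apply/pair_beforeP=> -[b]; lia. Qed.

Definition some_down (w : pred nat) t := has (fun a => ~~ w a) (iota 0 t).
Definition late_double_up (w : pred nat) :=
  pair_before (fun b => [&& w b, w b.+1 & some_down w b]).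
Definition later_double_down (w : pred nat) :=
  pair_before (fun c => [&& ~~ w c, ~~ w c.+1 & late_double_up w c]).

Lemma some_downS w t : some_down w t.+1 = some_down w t || ~~ w t.
Proof. by rewrite /some_down -addn1 iotaD has_cat /= orbF. Qed.

(** The states record the progress through D, UU, DD: 0 before the first D; 1 and
    2 after it, according to the last letter D or U; 3 and 4 after UU,
    according to the last letter U or D; 5 after DD, when U is refused. *)
Definition wide_up q := nth 5 [:: 0; 2; 3; 3; 3] q.
Definition wide_down q := nth 5 [:: 1; 1; 1; 4; 5] q.
Definition wide_allowed (q h : nat) := q != 5.

Lemma late_double_upS w t : late_double_up w t.+2 =
  late_double_up w t.+1 || [&& w t, w t.+1 & some_down w t.+1].
Proof.
rewrite /late_double_up pair_beforeS some_downS.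
by case: (w t); rewrite ?orbF.
Qed.

Lemma later_double_downS w t : later_double_down w t.+2 =
  later_double_down w t.+1 || [&& ~~ w t, ~~ w t.+1 & late_double_up w t.+1].
Proof.
rewrite /later_double_down pair_beforeS; congr (_ || _).
case wt: (w t) => //=; congr (_ && _); rewrite /late_double_up.
case: t wt => [|t] wt; first by rewrite !pair_before_small.
by rewrite pair_beforeS wt andbF orbF.
Qed.

(** The clause on the last letter makes it possible to recognise UU and DD. *)
Lemma wide_stateP w t (q := state_at wide_up wide_down 0 w t) :
  [/\ q <= 5, (0 < q) = some_down w t, (2 < q) = late_double_up w t,
      (4 < q) = later_double_down w t &
      forall s, t = s.+1 -> q < 5 -> w s = (q \in [:: 0; 2; 3])].
Proof.
rewrite {}/q; elim: t => [|[|t] [IH1 IH2 IH3 IH4 IH5]].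
- by split; rewrite // /late_double_up /later_double_down pair_before_small.
- rewrite /late_double_up /later_double_down !pair_before_small //=.
  rewrite /some_down /=.
  by case E: (w 0) => /=; split=> // s [<-]; rewrite E.
- rewrite late_double_upS later_double_downS (some_downS w t.+1) -IH2 -IH3 -IH4.
  have := IH5 t erefl.
  have -> : state_at wide_up wide_down 0 w t.+2 = (if w t.+1 then wide_up else wide_down)
    (state_at wide_up wide_down 0 w t.+1) by [].
  move: IH1; set q := state_at _ _ _ w t.+1.
  move: q => [|[|[|[|[|[|q]]]]]] // _; case E: (w t.+1); case E': (w t) => //= h;
    by [have := h isT | split=> // s [<-]; rewrite E].
Qed.

Lemma wide_wordP N w :
  wide_word N w <-> exists d, [/\ d < N, w d & later_double_down w d].
Proof.
split.
  case=> a [b [c [d [[ab bc cd dN] [wa /andP[wb wb1] /andP[wc wc1] wd]]]]].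
  exists d; split=> //; apply/pair_beforeP; exists c => //; rewrite wc wc1 /=.
  apply/pair_beforeP; exists b => //; rewrite wb wb1 /=.
  by apply/hasP; exists a => //; rewrite mem_iota.
case=> d [dN wd /pair_beforeP[c cd /and3P[wc wc1 /pair_beforeP[b bc]]]].
case/and3P=> wb wb1 /hasP[a]; rewrite mem_iota => ab wa.
by exists a, b, c, d; rewrite wb wb1 wc wc1; split.
Qed.

Lemma accepts_wideP s : accepts wide_up wide_down wide_allowed 0 0 s <->
  dyck_word (size s) (letter s) /\ ~ wide_word (size s) (letter s).
Proof.
rewrite dyck_acceptsP wide_wordP; split=> -[dw h]; split=> //.
  case=> d [dN wd dd]; have := h d dN wd; rewrite /wide_allowed.
  by have [le _ _ e _] := wide_stateP (letter s) d; rewrite dd in e; lia.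
move=> t tN wt; rewrite /wide_allowed; apply/eqP=> e; apply: h; exists t; split=> //.
by have [_ _ _ <- _] := wide_stateP (letter s) t; rewrite e.
Qed.

(** Whether the word is still in its initial run, of length r say; the truncated
    difference of r + 1 and the number of letters D read; whether the last letter
    is U. A valley is late exactly when the second component is 0. *)
Definition balanced_state := (bool * nat * bool)%type.
Definition balanced_up (q : balanced_state) : balanced_state :=
  let: (ini, e, l) := q in (ini, if ini then e.+1 else e, true).
Definition balanced_down (q : balanced_state) : balanced_state :=
  let: (ini, e, l) := q in (false, e.-1, false).
Definition balanced_allowed (q : balanced_state) h :=
  let: (ini, e, l) := q in [|| ini, l, 0 < e | h == 0].
Definition balanced_start : balanced_state := (true, 1, false).

Lemma balanced_stateP w t (q := state_at balanced_up balanced_down balanced_start w t) :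
  ((forall x, x < t -> w x) /\ (exists l, q = (true, t.+1, l))) \/
  (exists r, [/\ r < t, forall x, x < r -> w x, ~~ w r &
     q = (false, r.+1 - prefix_count (fun x => ~~ w x) t, w t.-1)]).
Proof.
rewrite {}/q; elim: t => [|t [[init [l IH]]|[r [rt init wr IH]]]]; rewrite /=.
- by left; split=> //; exists false.
- rewrite IH /=; case wt: (w t).
    left; split; last by exists true.
    by move=> x; rewrite ltnS leq_eqVlt => /orP[/eqP->|/init].
  right; exists t; rewrite wt; split=> //; congr (_, _, _).
  rewrite prefix_countS wt (@eq_prefix_count _ pred0) => [|x /init->//].
  have -> : prefix_count pred0 t = 0 by rewrite /prefix_count count_pred0.
  lia.
- right; exists r; split=> //; first lia.
  rewrite IH prefix_countS; case: (w t) => /=; first by rewrite addn0.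
  by congr (_, _, _); lia.
Qed.

Lemma accepts_balancedP s : accepts balanced_up balanced_down balanced_allowed balanced_start 0 s <->
  balanced_word (size s) (letter s).
Proof.
rewrite dyck_acceptsP /balanced_word; split=> -[dw h]; split=> //.
  move=> r t init wr /and4P[t0 tN wt1 wt] lt; have := h t tN wt.
  have [le _] := dw; have := le t (ltnW tN).
  have [[init' _]|[r' [rt' init' wr' ->]]] := balanced_stateP (letter s) t.
    by rewrite init' ?prednK // in wt1.
  have -> : r' = r.
    have [lt'|lt'|//] := ltngtP r' r; first by rewrite init in wr'.
    by rewrite init' in wr.
  by rewrite /balanced_allowed (negPf wt1); lia.
move=> t tN wt.
have [[_ [l ->]]//|[r [rt init wr ->]]] := balanced_stateP (letter s) t.
rewrite /balanced_allowed /=; case wt1: (letter s t.-1) => //=.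
have [//|le] := ltnP 0 (r.+1 - prefix_count (fun x => ~~ letter s x) t).
rewrite (h r t) ?subnn // /valley ?wt ?wt1 ?tN; lia.
Qed.

(** * Numbers of accepted words *)

Definition diagonal_sum (F : nat -> nat -> nat) n := \sum_(i < n.+1) F i (n - i).

(** Sum the recurrence over a diagonal; the boundary term [F n.+1 0 = 1] makes up
    for the term [F n 0 = 1] that the shifted sum leaves out. *)
Lemma diagonal_sumS (F A : nat -> nat -> nat) n :
  (forall o, F o 0 = 1) -> (forall k, F 0 k.+1 = A 0 k) ->
  (forall o k, F o.+1 k.+1 = A o.+1 k + F o k.+1) ->
  diagonal_sum F n.+1 = diagonal_sum A n + diagonal_sum F n.
Proof.
move=> F0 FA FS; rewrite /diagonal_sum big_ord_recl subn0 FA.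
rewrite big_ord_recr /= /bump /= add1n subnn F0.
rewrite (big_ord_recl _ (fun i => A _ _)) subn0 (big_ord_recr _ (fun i => F _ _)) /= subnn F0.
rewrite -!addnA; congr (_ + _); rewrite !addnA; congr (_ + _).
rewrite -big_split /=; apply: eq_bigr => i _; rewrite /bump /= add1n subSS.
by rewrite -(prednK (_ : 0 < n - i)) ?subn_gt0 // FS subnS.
Qed.

(** Unfolds the choice of the length of the initial run of U. *)
Lemma diagonal_sumE (a g : nat -> nat -> nat) h k :
  (forall h, a h 0 = g h 0) -> (forall h k, a h k.+1 = a h.+1 k + g h k.+1) ->
  a h k = \sum_(i < k.+1) g (h + i) (k - i).
Proof.
move=> a0 aS; elim: k h => [|k IH] h; first by rewrite big_ord1 addn0 a0.
rewrite aS IH [RHS]big_ord_recl addn0 subn0 addnC; congr (_ + _).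
by apply: eq_bigr => i _; rewrite lift0 addSnnS subSS.
Qed.

Definition half_pow2 k := if k is j.+1 then 2 ^ j else 0.

(** The numbers of completions in state 1 satisfy the recurrence of
    [diagonal_sumS], up to powers of 2 contributed by the states after UU. *)
Lemma wide_completions n (v := completions wide_up wide_down wide_allowed 0 0 n.+1) :
  2 * v = n * 2 ^ n + 2.
Proof.
rewrite {}/v; set C := completions _ _ _.
have C0 q h : C q h 0 = 1 by apply: completions0.
have CS q h k := completionsS wide_up wide_down wide_allowed q h k.
rewrite -/C in CS.
(* No letter U can be read from state 5. *)
have C5 h k : C 5 h k.+1 = 0.
  by elim: h => [|h IH]; rewrite CS //= -[wide_down 5]/5 IH.
have C4 h k : C 4 h k.+1 = C 3 h.+1 k.
  by rewrite CS /= -[wide_down 4]/5 C5; case: ifP; rewrite addn0.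
(* A positive height lets each of the k letters U come right after a letter U
   or after exactly one D. *)
have C3 h k : C 3 h.+1 k = 2 ^ k.
  elim: k h => [|k IH] h; first exact: C0.
  by rewrite CS /= -[wide_down 3]/4 -[wide_up 3]/3 C4 !IH expnS mul2n addnn.
have C2 h k : C 2 h.+1 k = C 1 h k + half_pow2 k.
  case: k => [|k]; first by rewrite !C0.
  by rewrite CS /= -[wide_down 2]/1 -[wide_up 2]/3 C3 addnC.
have C10 k : C 1 0 k.+1 = C 1 0 k + half_pow2 k.
  by rewrite CS /= -[wide_up 1]/2 C2 addn0.
have C1 h k : C 1 h.+1 k.+1 = C 1 h.+1 k + half_pow2 k + C 1 h k.+1.
  by rewrite CS /= -[wide_up 1]/2 -[wide_down 1]/1 C2.
have half_pow2E m : \sum_(i < m.+1) half_pow2 (m - i) + 1 = 2 ^ m.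
  elim: m => [|m IH]; first by rewrite big_ord1.
  rewrite big_ord_recl subn0 (eq_bigr (fun i : 'I_m.+1 => half_pow2 (m - i))); last first.
    by move=> i _; rewrite lift0 subSS.
  by rewrite /= -addnA IH addnn -mul2n -expnS.
have D m : 2 * diagonal_sum (C 1) m = m * 2 ^ m + 2.
  elim: m => [|m IH]; first by rewrite /diagonal_sum big_ord1 C0.
  rewrite (@diagonal_sumS _ (fun o k => C 1 o k + half_pow2 k)) //.
  rewrite {1}/diagonal_sum big_split /= -/(diagonal_sum _ _).
  move: (half_pow2E m) IH; rewrite expnS; move: (\sum_(i < _) _) (diagonal_sum _ _) (2 ^ m).
  by clear; nia.
rewrite -D CS /= addn0 -[wide_up 0]/0; congr (_ * _).
apply: (@diagonal_sumE (fun h k => C 0 h.+1 k) _ 0) => [h|h k]; first by rewrite !C0.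
by rewrite CS.
Qed.

(** As long as valleys are not late, the number of completions depends on the
    height only through the second component of the state, except when all
    arcs opened after the first D are closed; hence the two arrays G and g. *)
Lemma balanced_completions n
    (v := completions balanced_up balanced_down balanced_allowed balanced_start 0 n.+1) :
  2 * v = n * 2 ^ n + 2.
Proof.
rewrite {}/v; set C := completions _ _ _.
have C0 q h : C q h 0 = 1 by apply: completions0.
have CS q h k := completionsS balanced_up balanced_down balanced_allowed q h k.
rewrite -/C in CS.
(* After a late D, the word must come back to height 0 before the next U. *)
have z h k : C (false, 0, false) h k.+1 = C (false, 0, true) 1 k.
  by elim: h => [|h IH]; rewrite CS /= ?addn0.
have zt h k : C (false, 0, true) h.+1 k = 2 ^ k.
  elim: k h => [|k IH] h; first exact: C0.
  by rewrite CS /= z !IH expnS mul2n addnn.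
have e1 l h k : C (false, 1, l) h.+1 k = 2 ^ k.
  elim: k l h => [|k IH] l h; first exact: C0.
  by rewrite CS /= orbT z zt !IH expnS mul2n addnn.
(* With o arcs of the initial run still open and at least one other arc open,
   the number of other open arcs does not matter. *)
have indep o l m k : C (false, o.+1, l) (o + m).+1 k = C (false, o.+1, true) o.+1 k.
  elim: o l m k => [|o IHo] l m k; first by rewrite !e1.
  elim: k l m => [|k IHk] l m; first by rewrite !C0.
  have E1 := IHk true m.+1; have E2 := IHk true 1.
  have E3 := IHo false m k.+1; have E4 := IHo false 0 k.+1.
  rewrite ?addnS ?addn0 ?addSn in E1 E2 E3 E4.
  by rewrite CS [RHS]CS /= !orbT !addSn E1 E2 E3 E4.
pose G o k := C (false, o.+1, true) o.+1 k.
pose g o k := C (false, o.+1, false) o k.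
have G0 k : G 0 k = 2 ^ k by apply: e1.
have GS o k : G o.+1 k.+1 = G o.+1 k + G o k.+1.
  rewrite {1}/G CS /= /G -(indep o.+1 true 1) addn1; congr (_ + _).
  by rewrite -{2}(addn0 o) indep.
have g0 k : g 0 k.+1 = G 0 k by rewrite /g CS /= addn0.
have gS o k : g o.+1 k.+1 = G o.+1 k + g o k.+1 by rewrite /g CS.
have DG m : 2 * diagonal_sum G m = (m + 2) * 2 ^ m.
  elim: m => [|m IH]; first by rewrite /diagonal_sum big_ord1 G0.
  rewrite (@diagonal_sumS _ (fun o k => G o k + (o == 0) * 2 ^ k)) => [|o|k|o k].
  - rewrite {1}/diagonal_sum big_split /= -/(diagonal_sum _ _).
    rewrite (big_ord_recl _ (fun i => (_ == _) * _)) subn0 mul1n big1 ?addn0 //.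
    by move: IH; rewrite expnS; move: (diagonal_sum _ _) (2 ^ m); clear; nia.
  - exact: C0.
  - by rewrite !G0 mul1n expnS mul2n addnn.
  - by rewrite GS mul0n addn0.
have D m : 2 * diagonal_sum g m = m * 2 ^ m + 2.
  elim: m => [|m IH]; first by rewrite /diagonal_sum big_ord1 /g C0.
  rewrite (@diagonal_sumS _ G) // => [|o]; last exact: C0.
  move: (DG m) IH; rewrite expnS; move: (diagonal_sum G _) (diagonal_sum g _) (2 ^ m).
  by clear; nia.
rewrite -D CS /= addn0; congr (_ * _).
apply: (@diagonal_sumE (fun h k => C (true, h.+2, true) h.+1 k) _ 0) => [h|h k].
  by rewrite /g !C0.
by rewrite CS.
Qed.

(** * Cardinalities of the three classes *)

Definition avoiding_pairing m (ss : seq (seq (nat * nat))) N p : Prop :=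
  stoimenow_pairing N p /\
  (forall s, s \in ss -> ~ occurs N p m s).

Definition well_formed m (s : seq (nat * nat)) :=
  all (fun q => [&& 0 < q.1, q.1 < q.2 & q.2 <= 2 * m]) s.

Lemma in_stoimenow_avoiding m ss n (M : diagram n) : all (well_formed m) ss ->
  M \in stoimenow_avoiding (map (of_arcs m) ss) n <->
  is_matching M /\ avoiding_pairing m ss (2 * n) (partner M).
Proof.
move=> /allP wf; rewrite inE; split.
  case/and3P=> mM /(stoimenowP mM) sM /allP av; split=> //; split=> // s sin.
  by move/(containsP mM (wf s sin)); apply/negP/av/map_f.
case=> mM [sM av]; apply/and3P; split=> //; first exact/stoimenowP.
by apply/allP=> _ /mapP[s sin ->]; apply/negP=> /(containsP mM (wf s sin))/(av s sin).
Qed.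

Lemma eq_avoiding_pairing m ss N p q : 0 < m ->
  (forall x, x < N -> p x = q x) -> pairing N p ->
  avoiding_pairing m ss N p -> avoiding_pairing m ss N q.
Proof.
move=> m0 e pp [[s1 s2] av]; split.
  split=> i iN; rewrite -!e //; try exact: ltnW; [exact: s1 | exact: s2].
move=> s sin [x] /and4P[sx ox xN h]; apply: (av s sin); exists x.
apply/and4P; split=> //; apply: sub_all h => c; rewrite e //.
have [lt|ge] := ltnP c.1.-1 (size x).
  by move/allP: xN; apply; apply: mem_nth.
rewrite nth_default //; case: x sx xN {ox ge} => [|y x] sx /=; last by lia.
by move: sx; rewrite /=; lia.
Qed.

Lemma nonnesting_mirror N p : pairing N p -> nonnesting N p -> nonnesting N (mirror N p).
Proof.
move=> pp nn a u au up ua aN; rewrite /mirror in up ua aN.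
have [aN' uN'] : N.-1 - a < N /\ N.-1 - u < N by lia.
have [ka ku] := (pairingK pp aN', pairingK pp uN').
by apply: (nn (p (N.-1 - a)) (p (N.-1 - u))); rewrite ?ka ?ku; lia.
Qed.

Lemma P5_of_mirror_P4 N p : pairing N p ->
  occurs N (mirror N p) 4 arcs4 ->
  occurs N p 4 arcs5.
Proof.
move=> pp /occurrence_P4[a [b [c [d H]]]]; apply/occurrence_P5; rewrite /mirror in H.
have [aN bN] : N.-1 - a < N /\ N.-1 - b < N by lia.
have [cN dN] : N.-1 - c < N /\ N.-1 - d < N by lia.
have [ka kb] := (pairingK pp aN, pairingK pp bN).
have [kc kd] := (pairingK pp cN, pairingK pp dN).
exists (p (N.-1 - d)), (p (N.-1 - c)), (p (N.-1 - b)), (p (N.-1 - a)).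
by rewrite ka kb kc kd; lia.
Qed.

Lemma P4_of_mirror_P5 N p : pairing N p ->
  occurs N (mirror N p) 4 arcs5 ->
  occurs N p 4 arcs4.
Proof.
move=> pp /occurrence_P5[a [b [c [d H]]]]; apply/occurrence_P4; rewrite /mirror in H.
have [aN bN] : N.-1 - a < N /\ N.-1 - b < N by lia.
have [cN dN] : N.-1 - c < N /\ N.-1 - d < N by lia.
have [ka kb] := (pairingK pp aN, pairingK pp bN).
have [kc kd] := (pairingK pp cN, pairingK pp dN).
exists (p (N.-1 - d)), (p (N.-1 - c)), (p (N.-1 - b)), (p (N.-1 - a)).
by rewrite ka kb kc kd; lia.
Qed.

(** Reflection maps one class injectively into the other. *)
Lemma leq_card_mirror n (A B : {set diagram n}) (K L : (nat -> nat) -> Prop) :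
  (forall M, M \in A <-> is_matching M /\ K (partner M)) ->
  (forall M, M \in B <-> is_matching M /\ L (partner M)) ->
  (forall p q, (forall x, x < 2 * n -> p x = q x) -> pairing (2 * n) p -> L p -> L q) ->
  (forall p, pairing (2 * n) p -> K p -> L (mirror (2 * n) p)) ->
  #|A| <= #|B|.
Proof.
move=> AE BE Lext KL; pose f (M : diagram n) := diagram_of n (mirror (2 * n) (partner M)).
have fE M x : is_matching M -> x < 2 * n -> partner (f M) x = mirror (2 * n) (partner M) x.
  by move=> mM; apply/partner_diagram_of/mirror_pairing/partner_pairing.
have <- : #|f @: A| = #|A|.
  apply: card_in_imset => M M' /AE[mM _] /AE[mM' _] fMM'; apply: partner_inj => // x xN.
  have [pM pM'] := (partner_pairing mM, partner_pairing mM').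
  rewrite -(mirrorK pM xN) -(mirrorK pM' xN).
  have x'N : (2 * n).-1 - x < 2 * n by lia.
  by rewrite {1}/mirror -(fE M) // fMM' fE.
apply/subset_leq_card/subsetP=> _ /imsetP[M /AE[mM KM] ->]; apply/BE.
have pm := mirror_pairing (partner_pairing mM).
split; first exact: diagram_of_matching.
apply: Lext (KL _ (partner_pairing mM) KM) => // x xN; by rewrite fE.
Qed.

Lemma avoiding_pair s1 s2 N p :
  avoiding_pairing 4 [:: s1; s2] N p <->
  [/\ stoimenow_pairing N p, ~ occurs N p 4 s1 &
      ~ occurs N p 4 s2].
Proof.
split=> [[sp h]|[sp h1 h2]].
  by split=> //; apply: h; rewrite !inE eqxx ?orbT.
by split=> // s; rewrite !inE => /orP[] /eqP->.
Qed.

Lemma avoiding_P1 s N p : pairing N p ->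
  avoiding_pairing 4 [:: arcs1; s] N p <->
  nonnesting N p /\ ~ occurs N p 4 s.
Proof.
move=> pp; rewrite avoiding_pair -(nonnestingP pp); split=> [[]|[[]]] //.
Qed.

Lemma avoiding_P2_P3 N p : pairing N p ->
  avoiding_pairing 4 [:: arcs2; arcs3] N p <-> serial_pairing N p.
Proof.
move=> pp; rewrite avoiding_pair; split=> -[sp h2 h3]; split=> //.
- exact/no_wide_crossingP.
- exact/no_inner_crossingP.
- exact/no_wide_crossingP.
- exact/no_inner_crossingP.
Qed.

Lemma eq_dyck_word N (w w' : pred nat) :
  (forall x, x < N -> w x = w' x) -> dyck_word N w -> dyck_word N w'.
Proof.
move=> e [le eN].
have e1 t : t <= N -> prefix_count w' t = prefix_count w t.
  by move=> tN; apply: eq_prefix_count => x xt; rewrite e //; lia.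
have e2 t : t <= N -> prefix_count (fun x => ~~ w' x) t = prefix_count (fun x => ~~ w x) t.
  by move=> tN; apply: eq_prefix_count => x xt; rewrite e //; lia.
by split=> [t tN|]; rewrite e1 ?e2 // le.
Qed.

Lemma eq_late_valleys_balanced N (w w' : pred nat) :
  (forall x, x < N -> w x = w' x) ->
  late_valleys_balanced N w -> late_valleys_balanced N w'.
Proof.
move=> e h r t init wr vt lt; have tN : t < N by case/and4P: vt.
have e1 : prefix_count w' t = prefix_count w t.
  by apply: eq_prefix_count => x xt; rewrite e //; lia.
have e2 : prefix_count (fun x => ~~ w' x) t = prefix_count (fun x => ~~ w x) t.
  by apply: eq_prefix_count => x xt; rewrite e //; lia.
have rt : r < t.
  by apply: leq_trans lt _; rewrite -{2}(prefix_countC w' t) leq_addl.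
rewrite e1 e2 (h r) // -?e2 ?(eq_valley _ e) //; last by rewrite e //; lia.
by move=> x xr; rewrite e ?init //; lia.
Qed.

Lemma eq_wide_word N (w w' : pred nat) :
  (forall x, x < N -> w x = w' x) -> wide_word N w -> wide_word N w'.
Proof.
move=> e [a [b [c [d [[ab bc cd dN] h]]]]]; exists a, b, c, d; split=> //.
by rewrite -!e //; lia.
Qed.

Lemma card_P1_P4 n :
  #|stoimenow_avoiding [:: P1; P4] n| =
  completions balanced_up balanced_down balanced_allowed balanced_start 0 n.
Proof.
rewrite /completions add0n -mul2n.
apply: (@card_by_words n _ (avoiding_pairing 4 [:: arcs1; arcs4] (2 * n))) => //.
- by move=> M; apply: (@in_stoimenow_avoiding 4 [:: arcs1; arcs4]).
- by move=> p q; apply: eq_avoiding_pairing.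
- move=> p t pp /(avoiding_P1 _ pp)[nn no] wE.
  have eW x : x < 2 * n -> opener p x = letter t x by move=> xN; rewrite wE.
  apply/accepts_balancedP; rewrite size_tuple; split.
    exact: eq_dyck_word eW (pairing_dyck pp).
  exact: eq_late_valleys_balanced eW (no_P4_late_valleys pp nn no).
- move=> p q pp pq /(avoiding_P1 _ pp)[np _] /(avoiding_P1 _ pq)[nq _] e.
  apply: (nonnesting_unique (S := pred0)) => // a u _ _; [exact: np | exact: nq].
- move=> t /accepts_balancedP; rewrite size_tuple => -[dw lv].
  have [p [pp np e]] := dyck_nonnesting dw; exists p; split=> //.
  apply/(avoiding_P1 _ pp); split=> //.
  exact: late_valleys_no_P4 pp np (eq_late_valleys_balanced e lv).
Qed.

Lemma card_P1_P5 n :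
  #|stoimenow_avoiding [:: P1; P5] n| = #|stoimenow_avoiding [:: P1; P4] n|.
Proof.
have in4 M := @in_stoimenow_avoiding 4 [:: arcs1; arcs4] n M isT.
have in5 M := @in_stoimenow_avoiding 4 [:: arcs1; arcs5] n M isT.
apply/eqP; rewrite eqn_leq; apply/andP; split.
  apply: (leq_card_mirror in5 in4) => [p q|p pp]; first exact: eq_avoiding_pairing.
  move/(avoiding_P1 _ pp)=> [nn no]; apply/(avoiding_P1 _ (mirror_pairing pp)).
  by split; [exact: nonnesting_mirror | move/(P5_of_mirror_P4 pp)].
apply: (leq_card_mirror in4 in5) => [p q|p pp]; first exact: eq_avoiding_pairing.
move/(avoiding_P1 _ pp)=> [nn no]; apply/(avoiding_P1 _ (mirror_pairing pp)).
by split; [exact: nonnesting_mirror | move/(P4_of_mirror_P5 pp)].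
Qed.

Lemma card_P2_P3 n :
  #|stoimenow_avoiding [:: P2; P3] n| =
  completions wide_up wide_down wide_allowed 0 0 n.
Proof.
rewrite /completions add0n -mul2n.
apply: (@card_by_words n _ (avoiding_pairing 4 [:: arcs2; arcs3] (2 * n))) => //.
- by move=> M; apply: (@in_stoimenow_avoiding 4 [:: arcs2; arcs3]).
- by move=> p q; apply: eq_avoiding_pairing.
- move=> p t pp /(avoiding_P2_P3 pp) sp wE.
  apply/accepts_wideP; rewrite size_tuple; split.
    by apply: eq_dyck_word (pairing_dyck pp) => x xN; rewrite wE.
  by move/(eq_wide_word wE)/(serial_not_wide pp sp).
- move=> p q pp pq /(avoiding_P2_P3 pp) sp /(avoiding_P2_P3 pq) sq.
  exact: serial_unique.
- move=> t /accepts_wideP; rewrite size_tuple => -[dw nw].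
  have [p [pp pk nn e]] := dyck_peaked dw; exists p; split=> //.
  apply/(avoiding_P2_P3 pp)/(peaked_serial pp pk nn) => wide; apply: nw.
  by apply: eq_wide_word wide => x xN; rewrite e.
Qed.

(** * The power series *)

Import GRing.Theory.
Local Open Scope ring_scope.

Lemma denominatorE : (1 - 'X) * (1 - 2 * 'X) ^+ 2 = Poly [:: 1; -5; 8; -4] :> {poly int}.
Proof.
rewrite /= !cons_poly_def mul0r add0r.
rewrite -[1%:P]/(1 : {poly int}).
have -> : (-5)%:P = - 5 :> {poly int} by rewrite polyCN polyC_natr.
have -> : (8)%:P = 8 :> {poly int} by rewrite polyC_natr.
have -> : (-4)%:P = - 4 :> {poly int} by rewrite polyCN polyC_natr.
ring.
Qed.

Lemma numeratorE : 1 - 4 * 'X + 5 * 'X^2 - 'X^3 = Poly [:: 1; -4; 5; -1] :> {poly int}.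
Proof.
rewrite /= !cons_poly_def mul0r add0r.
rewrite -[1%:P]/(1 : {poly int}).
have -> : (-1)%:P = - 1 :> {poly int} by rewrite polyCN.
have -> : (5)%:P = 5 :> {poly int} by rewrite polyC_natr.
have -> : (-4)%:P = - 4 :> {poly int} by rewrite polyCN polyC_natr.
ring.
Qed.

Lemma sum_four_terms (f : nat -> int) n (u : nat -> int) : (forall k, (4 <= k)%N -> f k = 0) ->
  \sum_(k < n.+1) f k * u (n - k)%N = f 0 * u n + (if (0 < n)%N then f 1%N * u n.-1 else 0)
   + (if (1 < n)%N then f 2%N * u n.-2 else 0) + (if (2 < n)%N then f 3%N * u (n - 3)%N else 0).
Proof.
move=> f4; case: n => [|[|[|n]]]; rewrite !big_ord_recl ?big_ord0 /= ?subn0 ?addr0 ?addrA //.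
rewrite big1 ?addr0 // => i _; rewrite f4 ?mul0r //.
Qed.

Lemma sum_cubic (a b c d : int) n (u : nat -> int) :
  \sum_(k < n.+1) (Poly [:: a; b; c; d])`_k * u (n - k)%N =
  a * u n + (if (0 < n)%N then b * u n.-1 else 0)
   + (if (1 < n)%N then c * u n.-2 else 0) + (if (2 < n)%N then d * u (n - 3)%N else 0).
Proof.
have -> : \sum_(k < n.+1) (Poly [:: a; b; c; d])`_k * u (n - k)%N =
          \sum_(k < n.+1) [:: a; b; c; d]`_k * u (n - k)%N.
  by apply: eq_bigr => k _; rewrite coef_Poly.
rewrite (@sum_four_terms (nth 0 [:: a; b; c; d])) //.
by case=> [|[|[|[|k]]]] // _; rewrite /= nth_nil.
Qed.

(** By partial fractions, 1 / ((1 - x) (1 - 2 x)^2) equals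
    1 / (1 - x) + 4 x / (1 - 2 x)^2. *)
Lemma inverse_denominator n :
  fps_inv (fps_of_poly ((1 - 'X) * (1 - 2 * 'X) ^+ 2 : {poly int})) n =
  (n * 2 ^ n.+1 + 1)%N%:Z.
Proof.
set g := fps_of_poly _.
have gE k : g k = (Poly [:: 1; -5; 8; -4 : int])`_k by rewrite /g /fps_of_poly denominatorE.
have g0 : g 0%N = 1 by rewrite gE coef_Poly.
elim/ltn_ind: n => n IH.
have := @fps_mulrV int g; rewrite g0 => /(_ (unitr1 _) n).
rewrite /fps_mul (eq_bigr (fun k : 'I_n.+1 => (Poly [:: 1; -5; 8; -4])`_k * fps_inv g (n - k)%N)); last first.
  by move=> k _; rewrite gE.
rewrite sum_cubic mul1r /fps_of_poly coef1.
case: n IH => [|[|[|n]]] IH /=.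
- by rewrite !addr0 => ->.
- by rewrite (IH 0%N) //; lia.
- by rewrite (IH 0%N) // (IH 1%N) //; lia.
- by rewrite !subSS subn0 (IH n) ?(IH n.+1) ?(IH n.+2) ?expnS //; lia.
Qed.

Lemma coefficient_formula (a : nat -> nat) n :
  a 0 = 1%N -> (forall n, 2 * a n.+1 = n * 2 ^ n + 2)%N ->
  (a n)%:Z = fps_div (fps_of_poly (1 - 4 * 'X + 5 * 'X^2 - 'X^3 : {poly int}))
          (fps_of_poly ((1 - 'X) * (1 - 2 * 'X) ^+ 2 : {poly int})) n.
Proof.
move=> a0 aS; rewrite /fps_div /fps_mul.
rewrite (eq_bigr (fun k : 'I_n.+1 =>
   (Poly [:: 1; -4; 5; -1])`_k * ((n - k) * 2 ^ (n - k).+1 + 1)%N%:Z)); last first.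
  by move=> k _; rewrite inverse_denominator /fps_of_poly numeratorE.
rewrite (@sum_cubic _ _ _ _ _ (fun m => (m * 2 ^ m.+1 + 1)%N%:Z)).
case: n => [|[|[|n]]] /=.
- by rewrite a0.
- by have := aS 0%N; lia.
- by have := aS 1%N; lia.
- have := aS n.+2; rewrite !subSS subn0 !expnS; lia.
Qed.

Theorem theorem3p3 (S : seq (diagram 4))
    (hS : S \in [:: [:: P1; P4]; [:: P1; P5]; [:: P2; P3]]) :
  (fun n : nat => #|stoimenow_avoiding S n|%:Z) =1
  fps_div (fps_of_poly (1 - 4 * 'X + 5 * 'X^2 - 'X^3 : {poly int}))
          (fps_of_poly ((1 - 'X) * (1 - 2 * 'X) ^+ 2 : {poly int})).
Proof.
move=> n; apply: (coefficient_formula (a := fun n => #|stoimenow_avoiding S n|)).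
  move: hS; rewrite !inE => /or3P[] /eqP->.
  - by rewrite card_P1_P4 completions0.
  - by rewrite card_P1_P5 card_P1_P4 completions0.
  - by rewrite card_P2_P3 completions0.
move=> m; move: hS; rewrite !inE => /or3P[] /eqP->.
- by rewrite card_P1_P4 balanced_completions.
- by rewrite card_P1_P5 card_P1_P4 balanced_completions.
- by rewrite card_P2_P3 wide_completions.
Qed.
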